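(* Every graph of girth at least $6$ on at most $28$ vertices is $3$-colourable. Consequently $n_6(4)\ge 29$.
   Context: Graphs are finite, simple and undirected. The girth of a graph is the length of a shortest cycle (infinite if there is no cycle). For integers $k,g\ge 3$, $n_g(k)$ denotes the minimum number of vertices of a graph with chromatic number $k$ and girth at least $g$. A graph is $3$-colourable if it has a proper vertex colouring with at most $3$ colours. *)

(* Defs.v *)
From mathcomp Require Import all_boot.
From mathcomp Require Import boolp.

Set Implicit Arguments.
Unset Strict Implicit.
Unset Printing Implicit Defensive.

Record sgraph := SGraph {
  vertex :> finType;
  adj : rel vertex;
  adj_sym : symmetric adj;
  adj_irr : irreflexive adj
}.

(* [None] when no natural number satisfies [P]. *)
Definition min_nat (P : pred nat) : option nat :=
  match pselect (exists n, P n) with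
  | left exP => Some (ex_minn exP)
  | right _ => None
  end.

(* The bound [2 < n] excludes the empty sequence and the back-and-forth walk
   along one edge, both of which satisfy [ucycleb]. *)
Definition has_cycle (G : sgraph) (n : nat) : bool :=
  (2 < n) && [exists c : n.-tuple G, ucycleb (@adj G) c].

(* [None] stands for infinite girth. *)
Definition girth (G : sgraph) : option nat := min_nat (has_cycle G).

Definition girth_at_least (g : nat) (G : sgraph) : bool :=
  if girth G is Some m then g <= m else true.

Definition proper_colouring (G : sgraph) (k : nat) (f : {ffun G -> 'I_k}) : bool :=
  [forall x, forall y, adj x y ==> (f x != f y)].

Definition colourable (G : sgraph) (k : nat) : bool :=
  [exists f : {ffun G -> 'I_k}, proper_colouring f].

Lemma colourable_exists (G : sgraph) : exists k, colourable G k.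
Proof.
exists #|G|; apply/existsP; exists [ffun x => enum_rank x].
apply/forallP => x; apply/forallP => y; apply/implyP => xy.
rewrite !ffunE; apply/eqP => /enum_rank_inj eq_xy.
by rewrite eq_xy adj_irr in xy.
Qed.

Definition chromatic_number (G : sgraph) : nat :=
  ex_minn (colourable_exists G).

(* The number n_g(k). The value is 0 if there is no graph of chromatic number
   [k] and girth at least [g], so a positive lower bound on [min_order g k]
   entails that such a graph exists. *)
Definition min_order (g k : nat) : nat :=
  odflt 0 (min_nat (fun n =>
    `[< exists G : sgraph,
          [/\ #|G| = n, chromatic_number G = k & girth_at_least g G] >])).

(* Main.v *)
Require Import Defs.
From mathcomp Require Import all_boot.
From mathcomp Require Import boolp.
From mathcomp Require Import zify.

(** A graph is 3-colourable if it has an independent set [I], for the first colour,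
    whose complement [B] is bipartite. Girth 6 allows more: it is enough that [B]
    spans at most 13 edges ([three_colourable_of_few_arcs]). Indeed, take a vertex [x] of
    [B], give it the first colour and take that colour away from its neighbours in
    [I]. This yields a 3-colouring unless [B] without [x], extended by the neighbours
    of [x] in [I], contains an odd cycle. All these odd cycles, one for every [x], have
    to run through the few edges of [B], and vertices of [I] help little: two of them
    are never adjacent, and without 4-cycles they share at most one neighbour. A
    short exhaustive search ([refutation]), proved sound in [refutesP], shows that
    13 edges are not enough. The same search shows that in a graph of girth 6
    with at most 13 edges one vertex meets all odd cycles ([odd_transversal1]).

    Now let a graph of girth at least 6 with at most 28 vertices be minimal among those
    that are not 3-colourable. Its degrees are at least 3, and at least 14 edges
    avoid any given independent set ([independent_bound]). Two kinds of independent sets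
    belong to a vertex [v] and bound its surroundings. The first is [v] with its
    second neighbours ([nb2_bound]). The second consists of the neighbours of [v] and of
    half of the vertices at distance at least 3, once a few of these have been deleted
    to make the rest bipartite ([transversal_bound]). Call [deg v - 3] the excess of [v].
    The first bound, averaged over all vertices with the excess as weight, shows that
    the total excess is at most 10 ([exc_sum_le10]). All degrees are then 3 or 4,
    and around a vertex of degree 4 so few edges lie far away that a set of small
    total degree meets all odd cycles among them; then the second bound fails. For
    total excess 8, 9 and 10 such a vertex is found by another average, and for total
    excess 0 every vertex will do.

    The bound on [min_order] also needs a graph of girth at least 6 and chromatic number
    4. It comes from a construction of Blanche Descartes ([descartes]). *)

Set Implicit Arguments.
Unset Strict Implicit.
Unset Printing Implicit Defensive.

(** * Two-colourings and odd cycles *)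

Section TwoColouring.

Variables (T : finType) (e : rel T).
Hypothesis e_sym : symmetric e.

Definition two_colourable (S : {set T}) : Prop :=
  exists f : T -> bool, {in S &, forall x y, e x y -> f x != f y}.

Definition odd_cycle (S : {set T}) (c : seq T) : Prop :=
  [/\ {subset c <= S}, cycle e c, odd (size c) & uniq c].

Lemma non_uniq_split (c : seq T) :
  ~~ uniq c -> exists x c0 c1 c2, c = c0 ++ x :: c1 ++ x :: c2.
Proof.
elim: c => // y c IHc /=; rewrite negb_and negbK => /orP[yc|/IHc].
  by case/splitPr: yc => c1 c2; exists y, [::], c1, c2.
by move=> [x [c0 [c1 [c2 ->]]]]; exists x, (y :: c0), c1, c2.
Qed.

(** A closed walk that repeats a vertex splits there into two shorter closed
    walks, and one of the two has odd length. *)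
Lemma odd_closed_walk_cycle (S : {set T}) (c : seq T) :
  {subset c <= S} -> cycle e c -> odd (size c) -> exists c', odd_cycle S c'.
Proof.
elim/ltn_ind: {c}(size c) {-2}c (erefl (size c)) => n IHn c sz_c cS ce co.
have [uc|/non_uniq_split] := boolP (uniq c); first by exists c.
move=> [x [c0 [c1 [c2 def_c]]]].
have def_c' : (x :: c1 ++ x :: c2) ++ c0 = (x :: c1) ++ x :: c2 ++ c0.
  by rewrite -cat_cons -catA.
have eq_c : perm_eq c ((x :: c1) ++ x :: c2 ++ c0).
  by rewrite def_c -def_c' perm_catC.
have ce' : cycle e ((x :: c1) ++ x :: c2 ++ c0).
  by rewrite -def_c' cycle_catC -def_c.
have sz : size (x :: c1) + size (x :: c2 ++ c0) = n.
  by rewrite -size_cat -(perm_size eq_c) sz_c.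
have [ce1 ce2] : cycle e (x :: c1) /\ cycle e (x :: c2 ++ c0).
  move: ce'; rewrite /= rcons_cat cat_path /= => /and3P[pc1 lc1 pc2].
  by rewrite rcons_path pc1 lc1.
have c1S : {subset x :: c1 <= S}.
  by move=> z zc; apply: cS; rewrite (perm_mem eq_c) mem_cat zc.
have c2S : {subset x :: c2 ++ c0 <= S}.
  by move=> z zc; apply: cS; rewrite (perm_mem eq_c) mem_cat zc orbT.
have [o1|o1] := boolP (odd (size (x :: c1))).
  by apply: (IHn (size (x :: c1)) _ (x :: c1)); rewrite // -sz -addn1 leq_add2l.
apply: (IHn (size (x :: c2 ++ c0)) _ (x :: c2 ++ c0)) => //.
  by rewrite -sz -add1n leq_add2r.
by move: co; rewrite sz_c -sz oddD (negbTE o1).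
Qed.

Let eS (S : {set T}) : rel T := fun x y => [&& x \in S, y \in S & e x y].

Let eS_sym S : symmetric (eS S).
Proof. by move=> x y; rewrite /eS e_sym; case: (x \in S); case: (y \in S). Qed.

Let path_eS S x p : path (eS S) x p -> path e x p /\ {subset p <= S}.
Proof.
elim: p x => //= y p IHp x /andP[/and3P[_ yS exy] /IHp[pe pS]].
rewrite exy pe; split=> // z; rewrite inE => /predU1P[->//|]; exact: pS.
Qed.

(** Colour a vertex by the parity of some walk to it from a chosen root of its
    component. If two adjacent vertices get the same colour, their walks and the
    edge between them form an odd closed walk. *)
Lemma two_colourable_or_odd_cycle (S : {set T}) :
  two_colourable S \/ exists c, odd_cycle S c.
Proof.
have [oc|noc] := EM (exists c, odd_cycle S c); [by right | left].
pose r x := root (eS S) x; have cS := sym_connect_sym (@eS_sym S).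
have rP x : exists2 p, path (eS S) (r x) p & last (r x) p = x.
  have /connectP[p pP def_x] : connect (eS S) (r x) x.
    by rewrite cS connect_root.
  by exists p.
pose f x := `[< exists p, [/\ path (eS S) (r x) p, last (r x) p = x
                           & odd (size p)] >].
have fE x : exists p, [/\ path (eS S) (r x) p, last (r x) p = x
                           & odd (size p) = f x].
  have [/asboolP[p [p1 p2 p3]]|] := boolP (f x); first by exists p.
  move=> /asboolP nfx; have [p p1 p2] := rP x; exists p; split=> //.
  by apply/negP => op; apply: nfx; exists p.
exists f => x y xS yS exy; apply/eqP => fxy; apply: noc.
have exyS : eS S x y by rewrite /eS xS yS.
have rxy : r y = r x.
  by apply/eqP; rewrite root_connect // cS connect1.
have [p [p1 p2 p3]] := fE x; have [q [q1 q2 q3]] := fE y.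
rewrite rxy in q1 q2.
pose w := y :: rev (belast (r x) q) ++ p.
have wP : cycle (eS S) w.
  rewrite /w /= rcons_cat cat_path rcons_path.
  have := rev_path (eS S) (r x) q; rewrite q2 => ->.
  rewrite (eq_path (e' := eS S)) => [|z t]; last exact: eS_sym.
  rewrite q1 /= (_ : last y _ = r x) ?p1 ?p2 //.
  by case: (q) q2 => [/= -> //|a s _ /=]; rewrite rev_cons last_rcons.
have [we wS] : cycle e w /\ {subset w <= S}.
  have [we wS] := path_eS wP; split=> // z zw; apply: wS.
  by rewrite mem_rcons.
apply: (odd_closed_walk_cycle wS we).
by rewrite /w /= size_cat size_rev size_belast oddD p3 q3 fxy addbb.
Qed.

End TwoColouring.

(** * A search for odd cycles with few edges *)

(** The last clause speaks of closed walks of length 5, not only of cycles: next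
    to the first clause this is no stronger, and it spares the side conditions on
    distinct vertices. *)
Definition short_cycle_free (T : finType) (e : rel T) : Prop :=
  [/\ forall x y z, e x y -> e y z -> ~~ e z x,
      forall x y z w, x != z -> y != w ->
        e x y -> e y z -> e z w -> ~~ e w x
    & forall x y z w v, e x y -> e y z -> e z w -> e w v -> ~~ e v x].

(** Every edge inside [S] counts twice here, once in each direction. *)
Definition arcs (T : finType) (e : rel T) (S : {set T}) : {set T * T} :=
  [set p | [&& p.1 \in S, p.2 \in S & e p.1 p.2]].

(** Sets of vertices of a partial subgraph are bit sequences, padded with [false]. The
    nested conditionals of the functions below, in place of boolean connectives,
    keep call-by-value evaluation from running both branches. *)
Fixpoint union_bits (a b : bitseq) : bitseq :=
  match a, b with
  | [::], _ => b
  | _, [::] => a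
  | x :: a', y :: b' => (if x then true else y) :: union_bits a' b'
  end.

Fixpoint neighbours (rows : seq bitseq) (m : bitseq) : bitseq :=
  match rows, m with
  | r :: rows', b :: m' =>
      if b then union_bits r (neighbours rows' m') else neighbours rows' m'
  | _, _ => [::]
  end.

Definition set_bit (m : bitseq) (i : nat) : bitseq := set_nth false m i true.

(** A partial subgraph of an unknown graph whose vertices fall into an inner part [B]
    and an independent outer part. Row [i] of [rows] holds the known neighbours of
    vertex [i], [outer] tells the part of each vertex, and [budget] is the
    number of further edges that may still appear inside [B]. *)
Record state := State { rows : seq bitseq; outer : bitseq; budget : nat }.

Definition known (st : state) (i j : nat) : bool :=
  nth false (nth [::] (rows st) i) j.

Definition add_arc (r : seq bitseq) (i j : nat) : seq bitseq :=
  set_nth [::] r i (set_bit (nth [::] r i) j).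

(** An edge between vertices that are joined by a known walk of length 2, 3 or 4,
    but not by a known edge, would close a cycle of length at most 5. *)
Definition ball4 (st : state) (i : nat) : bitseq :=
  let n1 := nth [::] (rows st) i in
  let n2 := neighbours (rows st) n1 in
  let n3 := neighbours (rows st) n2 in
  union_bits (set_bit n2 i) (union_bits n3 (neighbours (rows st) n3)).

(** Calls the continuation [k] on the state enriched with the edge [i j]. The answer is
    [true] at once if no such edge is possible: a short cycle, two outer vertices,
    or an exhausted budget. Throughout, the answer [true] means that the partial
    subgraph cannot be completed. *)
Definition with_edge (st : state) (i : nat) (near : bitseq) (j : nat)
    (k : state -> bool) : bool :=
  if known st i j then k st
  else if nth false near j then true
  else
    let r := add_arc (add_arc (rows st) i j) j i in
    if nth false (outer st) i then
      if nth false (outer st) j then true else k (State r (outer st) (budget st))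
    else if nth false (outer st) j then k (State r (outer st) (budget st))
    else if budget st is b.+1 then k (State r (outer st) b) else true.

Definition add_vertex (st : state) (o : bool) : state :=
  State (rows st) (rcons (outer st) o) (budget st).

Fixpoint all_unmarked (f : nat -> bool -> bool) (i : nat) (ks marks : bitseq)
    : bool :=
  if ks is o :: ks' then
    if head false marks then all_unmarked f i.+1 ks' (behead marks)
    else if f i o then all_unmarked f i.+1 ks' (behead marks) else false
  else true.

(** Runs through all odd cycles that start with an already known path from [s] to
    [u]; [par] is the parity of the number of vertices of that path and [marks]
    holds the known vertices that the rest of the cycle must avoid. The cycle lives
    in [B] without [x], together with the outer neighbours of [x] if [use_outer]
    holds, so an outer vertex comes with its edge to [x]. The four nested tests are
    the ways to go on: back to [s], to a known vertex, to a new inner vertex, to a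
    new outer vertex. *)
Fixpoint extend (fuel : nat) (use_outer : bool) (x s u : nat) (par : bool)
    (marks : bitseq) (k : state -> bool) (st : state) : bool :=
  if fuel is f.+1 then
    let near := ball4 st u in
    let n := size (outer st) in
    if (if par then with_edge st u near s k else true) then
    if all_unmarked (fun w o =>
         if o then
           if use_outer then
             with_edge st u near w (fun st' =>
               with_edge st' w (ball4 st' w) x
                 (extend f use_outer x s w (~~ par) (set_bit marks w) k))
           else true
         else with_edge st u near w
                (extend f use_outer x s w (~~ par) (set_bit marks w) k))
       0 (outer st) marks then
    if with_edge (add_vertex st false) u near n
         (extend f use_outer x s n (~~ par) (set_bit marks n) k) then
    if use_outer then
      with_edge (add_vertex st true) u near n (fun st' =>
        with_edge st' n (ball4 st' n) x
          (extend f use_outer x s n (~~ par) (set_bit marks n) k))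
    else true
    else false else false else false
  else false.

(** Runs through all odd cycles in [B] without [x], extended by the outer neighbours
    of [x]. A cycle with an outer vertex is rotated to start there. The
    other cycles start at their least known vertex, which is why the vertices below
    [s] are marked; those without any known vertex start at a new vertex. *)
Definition swap (fuel x : nat) (k : state -> bool) (st : state) : bool :=
  let n := size (outer st) in
  let here := set_bit [::] x in
  if n <= x then false else if nth false (outer st) x then false else
  if all_unmarked (fun s o =>
       if o then
         with_edge st s (ball4 st s) x
           (extend fuel true x s s true (set_bit here s) k)
       else
         extend fuel false x s s true
           (set_bit (nseq s.+1 true) x) k st)
     0 (outer st) here then
  if with_edge (add_vertex st true) n (ball4 st n) x
       (extend fuel true x n n true (set_bit here n) k) then
    extend fuel false x n n true (nseq n.+1 true) k (add_vertex st false)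
  else false else false.

Fixpoint some (f : nat -> bool) (s : seq nat) : bool :=
  if s is x :: s' then if f x then true else some f s' else false.

(** Looks for a vertex [x] among [xs] such that none of the odd cycles of [swap x]
    can be added; failing that, for an [x] such that each of the resulting states is
    refuted in turn. *)
Fixpoint refute (fuel depth : nat) (xs : seq nat) (st : state) : bool :=
  if some (fun x => swap fuel x (fun=> false) st) xs then true
  else if depth is d.+1 then some (fun x => swap fuel x (refute fuel d xs) st) xs
  else false.

Definition initial_state (b : nat) := State [::] [:: false] b.

(** Through a first inner vertex the search draws an odd cycle inside [B]; then it swaps
    that vertex. *)
Definition refutes (fuel depth : nat) (xs : seq nat) (b : nat) : bool :=
  extend fuel false 0 0 0 true [:: true]
    (swap fuel 0 (refute fuel depth xs)) (initial_state b).

(** * Soundness of the search *)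

Section Soundness.

Variables (T : finType) (e : rel T) (B : {set T}) (cap : nat).
Hypotheses (e_sym : symmetric e) (e_irr : irreflexive e).
Hypothesis short : short_cycle_free e.
Hypothesis outer_indep : forall x y, x \notin B -> y \notin B -> ~~ e x y.
Hypothesis few_arcs : #|arcs e B| <= cap.*2.+1.

(** [sg] lists the actual vertices that the numbers of the state stand for. The set
    of arcs [D] at the end certifies the budget: known edges inside [B] have used up
    what is missing from [cap]. *)
Definition represents (st : state) (sg : seq T) : Prop :=
  [/\ uniq sg, size sg = size (outer st),
      forall i x0, i < size sg -> nth false (outer st) i = (nth x0 sg i \notin B),
      forall i j x0, known st i j ->
        [/\ i < size sg, j < size sg, known st j i & e (nth x0 sg i) (nth x0 sg j)]
    & exists D : {set T * T}, [/\ D \subset arcs e B,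
        cap.*2 <= #|D| + (budget st).*2
      & forall p x0, p \in D ->
          exists i j, known st i j /\ p = (nth x0 sg i, nth x0 sg j)]].

Lemma nth_union_bits a b i :
  nth false (union_bits a b) i = nth false a i || nth false b i.
Proof.
by elim: a b i => [|x a IHa] [|y b] [|i] //=; rewrite ?nth_nil ?orbF.
Qed.

Lemma neighboursP r m j : nth false (neighbours r m) j ->
  exists2 i, nth false m i & nth false (nth [::] r i) j.
Proof.
elim: r m => [|a r IHr] [|b m] /=; rewrite ?nth_nil //.
case: b => [|/IHr[i mi ri]]; last by exists i.+1.
by rewrite nth_union_bits => /orP[aj|/IHr[i mi ri]]; [exists 0|exists i.+1].
Qed.

Lemma ball4_far st sg i j x0 : represents st sg -> i < size sg -> j < size sg ->
  ~~ known st i j -> nth false (ball4 st i) j -> ~~ e (nth x0 sg i) (nth x0 sg j).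
Proof.
move=> [usg _ _ kP _] lti ltj nij; have [C3 C4 C5] := short.
have kE a b : known st a b -> e (nth x0 sg a) (nth x0 sg b).
  by move=> /(kP _ _ x0)[].
have kS a b : known st a b -> known st b a by move=> /(kP _ _ x0)[].
have ne a b : known st i a -> known st b j -> nth x0 sg a != nth x0 sg j
    /\ nth x0 sg i != nth x0 sg b.
  move=> ia bj; have [[_ lta _ _] [ltb _ _ _]] := (kP _ _ x0 ia, kP _ _ x0 bj).
  rewrite !nth_uniq //.
  split; apply: contraNneq nij => eq_ab; first by rewrite -eq_ab.
  by rewrite eq_ab.
rewrite !nth_union_bits nth_set_nth /= => /or3P[].
- case: eqP => [->|_ /neighboursP[a ia aj]]; first by rewrite e_irr.
  by rewrite e_sym; apply: C3 (kE _ _ ia) (kE _ _ aj).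
- move=> /neighboursP[b /neighboursP[a ia ab] bj].
  have [n1 n2] := ne _ _ ia bj.
  by rewrite e_sym; apply: C4 n2 n1 (kE _ _ ia) (kE _ _ ab) (kE _ _ bj).
move=> /neighboursP[c /neighboursP[b /neighboursP[a ia ab] bc] cj].
by rewrite e_sym; apply: C5 (kE _ _ ia) (kE _ _ ab) (kE _ _ bc) (kE _ _ cj).
Qed.

Lemma known_add_edge st i j o b a c :
  known (State (add_arc (add_arc (rows st) i j) j i) o b) a c =
  [|| (a == i) && (c == j), (a == j) && (c == i) | known st a c].
Proof.
have nth_arc q u v y z : nth false (nth [::] (add_arc q u v) y) z =
    ((y == u) && (z == v)) || nth false (nth [::] q y) z.
  rewrite /add_arc /set_bit nth_set_nth /=; have [->|//] := eqVneq y u.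
  by rewrite nth_set_nth /=; case: (z == v).
by rewrite /known /= !nth_arc orbCA.
Qed.

(** A real edge is never rejected. For an edge inside [B], the two new arcs enlarge the
    certificate [D]; had the budget been zero, there would be more than [cap] edges
    inside [B]. *)
Lemma with_edgeP st sg i j x0 k : represents st sg ->
  i < size sg -> j < size sg -> e (nth x0 sg i) (nth x0 sg j) ->
  with_edge st i (ball4 st i) j k ->
  exists st', represents st' sg /\ k st'.
Proof.
move=> rep lti ltj eij; rewrite /with_edge.
have [kij|nkij] := boolP (known st i j); first by exists st.
case: ifP => [near|_].
  by have := ball4_far x0 rep lti ltj nkij near; rewrite eij.
have [usg szo oP kP [D [DB Dcap DP]]] := rep.
have symk a b : known st a b -> known st b a by move=> /(kP _ _ x0)[].
have kP' r' b' (kr : forall a c, known (State r' (outer st) b') a c =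
    [|| (a == i) && (c == j), (a == j) && (c == i) | known st a c]) :
  forall a c y0, known (State r' (outer st) b') a c ->
   [/\ a < size sg, c < size sg, known (State r' (outer st) b') c a
     & e (nth y0 sg a) (nth y0 sg c)].
  move=> a c y0; rewrite !kr.
  have eijy : e (nth y0 sg i) (nth y0 sg j).
    by rewrite (set_nth_default x0) // (set_nth_default x0 y0).
  move=> /or3P[/andP[/eqP-> /eqP->]|/andP[/eqP-> /eqP->]|/(kP _ _ y0)[? ? -> ?]].
  - by rewrite !eqxx orbT.
  - by rewrite !eqxx e_sym.
  - by rewrite !orbT.
have outerE a : a < size sg -> nth false (outer st) a = (nth x0 sg a \notin B).
  exact: oP.
have main b' : (nth false (outer st) i || nth false (outer st) j) ->
    budget st = b' ->
    represents (State (add_arc (add_arc (rows st) i j) j i) (outer st) b') sg.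
  move=> oij <-; split=> //; first by apply: kP' => a c; rewrite known_add_edge.
  exists D; split=> // pr y0 /(DP _ y0)[a [c [kac ->]]].
  by exists a, c; rewrite known_add_edge kac !orbT.
case: ifP => oi; last case: ifP => oj.
- case: ifP => oj.
    by have := outer_indep (x := nth x0 sg i) (y := nth x0 sg j);
       rewrite -!outerE // eij => /(_ oi oj).
  by move=> ks; eexists; split; [apply: main; rewrite ?oi|exact: ks].
- by move=> ks; eexists; split; [apply: main; rewrite ?oj ?orbT|exact: ks].
set p := nth x0 sg i in eij *; set q := nth x0 sg j in eij *.
have [pB qB] : p \in B /\ q \in B.
  by rewrite -[p \in B]negbK -[q \in B]negbK -!outerE // oi oj.
pose D' := (p, q) |: ((q, p) |: D).
have D'B : D' \subset arcs e B.
  by rewrite !subUset !sub1set DB !inE /= pB qB eij e_sym eij.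
have cardD' : #|D'| = #|D|.+2.
  have npq : p != q by apply: contraTneq eij => ->; rewrite e_irr.
  have inD a c : a < size sg -> c < size sg ->
      (nth x0 sg a, nth x0 sg c) \in D -> known st a c.
    move=> lta ltc /(DP _ x0)[a' [c' [kac]]]; have [lta' ltc' _ _] := kP _ _ x0 kac.
    move=> [/eqP]; rewrite nth_uniq // => /eqP-> /eqP.
    by rewrite nth_uniq // => /eqP->.
  have pqD : (p, q) \notin D by apply: contra nkij; apply: inD.
  have qpD : (q, p) \notin D.
    by apply: contra nkij => /inD kji; apply/symk/kji.
  by rewrite !cardsU1 !inE xpair_eqE (negbTE npq) /= pqD qpD.
have capD' := leq_trans (subset_leq_card D'B) few_arcs.
case bE: (budget st) => [|b].
  by exfalso; move: capD' Dcap; rewrite bE cardD'; clear; lia.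
move=> ks; eexists; split; last exact: ks.
split=> //; first by apply: kP' => a c; rewrite known_add_edge.
exists D'; split=> //; first by move: Dcap; rewrite bE cardD' /=; clear; lia.
move=> pr y0; rewrite !inE => /or3P[/eqP->|/eqP->|/(DP _ y0)[a [c [kac ->]]]].
- exists i, j; rewrite known_add_edge !eqxx /p /q.
  by rewrite (set_nth_default x0) // (set_nth_default x0 y0).
- exists j, i; rewrite known_add_edge !eqxx orbT /p /q.
  by rewrite (set_nth_default x0) // (set_nth_default x0 y0).
- by exists a, c; rewrite known_add_edge kac !orbT.
Qed.

Lemma represents_add st sg w o : represents st sg -> w \notin sg ->
  o = (w \notin B) -> represents (add_vertex st o) (rcons sg w).
Proof.
move=> [usg szo oP kP [D [DB Dcap DP]]] wsg ->.
have kP' i j x0 : known st i j ->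
    [/\ i < size (rcons sg w), j < size (rcons sg w), known st j i
      & e (nth x0 (rcons sg w) i) (nth x0 (rcons sg w) j)].
  move=> /(kP _ _ x0)[lti ltj kji eij].
  by rewrite !nth_rcons lti ltj size_rcons !ltnS !(ltnW lti, ltnW ltj).
split=> //; rewrite ?rcons_uniq ?wsg ?size_rcons ?szo //.
  move=> i x0; rewrite ltnS leq_eqVlt !nth_rcons szo => /predU1P[->|lti].
    by rewrite !ltnn eqxx.
  by rewrite lti (oP _ x0) ?szo.
exists D; split=> // p x0 /(DP _ x0)[i [j [kij ->]]]; exists i, j; split=> //.
by have [lti ltj _ _] := kP _ _ x0 kij; rewrite !nth_rcons lti ltj.
Qed.

Lemma all_unmarkedP f n ks marks j : all_unmarked f n ks marks -> j < size ks ->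
  ~~ nth false marks j -> f (n + j) (nth false ks j).
Proof.
elim: ks n marks j => //= o ks IHks n marks [|j] h.
  by move: h; rewrite addn0 nth0; case: (head _ _) => //; case: (f n o).
rewrite ltnS -addSnnS -nth_behead; apply: IHks.
by move: h; case: (head _ _) => //; case: (f n o).
Qed.

(** The vertices whose colour is free when [x] joins the outer side: outer vertices not
    adjacent to [x] can keep the colour of that side. *)
Definition beside (x : T) : {set T} :=
  [set y | if y \in B then y != x else e x y].

Definition absurd_for (k : state -> bool) : Prop :=
  forall st sg, represents st sg -> k st -> False.

(** The witness is the remaining part [p] of an actual odd cycle. Its first vertex
    selects the branch of [extend] that is followed. *)
Lemma extendP fuel use_outer x s u par marks k st sg p x0 :
    extend fuel use_outer x s u par marks k st -> represents st sg ->
    x < size sg -> s < size sg -> u < size sg -> nth x0 sg x \in B ->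
    absurd_for k ->
    path e (nth x0 sg u) (rcons p (nth x0 sg s)) ->
    {subset p <= beside (nth x0 sg x)} ->
    (use_outer \/ {subset p <= B}) -> uniq p ->
    (forall i, i < size sg -> nth false marks i -> nth x0 sg i \notin p) ->
    par (+) odd (size p) -> False.
Proof.
elim: fuel u par marks st sg p => //= fuel IH u par marks st sg p.
move=> ext rep ltx lts ltu xB kabs pP pH pI up pM pO.
have [usg szo oP kP _] := rep.
case: p => [|w p] /= in pP pH pI up pM pO.
  move: ext; rewrite addbF in pO; rewrite pO; case: ifP => // cl _.
  rewrite andbT in pP; have [st' [rep' kst']] := with_edgeP rep ltu lts pP cl.
  exact: (kabs _ _ rep' kst').
move: pP up => /andP[euw pP] /andP[wp up].
have wH : w \in beside (nth x0 sg x) by apply: pH; rewrite mem_head.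
have pH' : {subset p <= beside (nth x0 sg x)}.
  by move=> z zp; apply: pH; rewrite inE zp orbT.
have pI' : use_outer \/ {subset p <= B}.
  by case: pI => [|pB]; [left|right=> z zp; apply: pB; rewrite inE zp orbT].
have pO' : ~~ par (+) odd (size p) by move: pO; rewrite addbN addNb.
move: ext; case: ifP => // _; case: ifP => // known_w; case: ifP => // new_w new_o.
have [wsg|wsg] := boolP (w \in sg).
  pose j := index w sg.
  have ltj : j < size sg by rewrite index_mem.
  have jE : nth x0 sg j = w by rewrite nth_index.
  have jM : ~~ nth false marks j.
    by apply: contraL (mem_head w p) => /(pM _ ltj); rewrite jE.
  have pM' i : i < size sg -> nth false (set_bit marks j) i -> nth x0 sg i \notin p.
    rewrite /set_bit nth_set_nth /=; case: eqP => [->|_ lti /(pM _ lti)].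
      by rewrite jE.
    by rewrite inE negb_or => /andP[].
  rewrite szo in ltj; have := all_unmarkedP known_w ltj jM.
  rewrite -szo in ltj; rewrite add0n (oP _ x0 ltj) jE; rewrite -jE in euw pP.
  case: ifP => wB; last first.
    move=> /(with_edgeP rep ltu ltj euw)[st' [rep' ext']].
    by apply: (IH _ _ _ _ _ p ext' rep').
  have oT : use_outer by case: pI => // pB; rewrite pB ?mem_head in wB.
  case: ifP => [_|]; last by rewrite oT.
  move=> /(with_edgeP rep ltu ltj euw)[st' [rep' st'P]].
  have ejx : e (nth x0 sg j) (nth x0 sg x).
    by move: wH; rewrite inE (negbTE wB) e_sym jE.
  have [st2 [rep2 ext2]] := with_edgeP rep' ltj ltx ejx st'P.
  by apply: (IH _ _ _ _ _ p ext2 rep2); case: pI'; auto.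
have rep_w := represents_add rep wsg erefl.
pose n := size (outer st); pose sg' := rcons sg w.
have nE : nth x0 sg' n = w by rewrite nth_rcons szo ltnn eqxx.
have ltn : n < size sg' by rewrite size_rcons szo.
have old i : i < size sg -> nth x0 sg' i = nth x0 sg i by rewrite nth_rcons => ->.
have lt' i : i < size sg -> i < size sg' by rewrite size_rcons => /ltnW.
have pM' i : i < size sg' -> nth false (set_bit marks n) i -> nth x0 sg' i \notin p.
  rewrite size_rcons ltnS leq_eqVlt /set_bit nth_set_nth /= szo.
  case: eqP => [-> _ _|_ /= lti]; first by rewrite nE.
  rewrite old ?szo // => /(pM _ _); rewrite szo => /(_ lti).
  by rewrite inE negb_or => /andP[].
have euw' : e (nth x0 sg' u) (nth x0 sg' n) by rewrite nE old.
have pP' : path e (nth x0 sg' n) (rcons p (nth x0 sg' s)) by rewrite nE old.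
have xB' : nth x0 sg' x \in B by rewrite old.
have pH2 : {subset p <= beside (nth x0 sg' x)} by rewrite old.
have [ltx' lts' ltu'] := And3 (lt' _ ltx) (lt' _ lts) (lt' _ ltu).
have [wB|wB] := boolP (w \in B).
  rewrite wB /= in rep_w.
  have [st' [rep' ext']] := with_edgeP rep_w ltu' ltn euw' new_w.
  by apply: (IH _ _ _ _ _ p ext' rep').
rewrite wB in rep_w.
have oT : use_outer by case: pI => // pB; rewrite pB ?mem_head in wB.
move: new_o; case: ifP => [_ new_o|]; last by rewrite oT.
have [st' [rep' st'P]] := with_edgeP rep_w ltu' ltn euw' new_o.
have enx : e (nth x0 sg' n) (nth x0 sg' x).
  by move: wH; rewrite inE (negbTE wB) e_sym nE old.
have [st2 [rep2 ext2]] := with_edgeP rep' ltn ltx' enx st'P.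
by apply: (IH _ _ _ _ _ p ext2 rep2) => //; left.
Qed.


Hypothesis every_swap : forall x, x \in B -> exists c, odd_cycle e (beside x) c.

Lemma swapP fuel x k st sg :
  swap fuel x k st -> represents st sg -> absurd_for k -> False.
Proof.
move=> + rep kabs; rewrite /swap; case: leqP => // ltx; case: ifP => // ox.
have [usg szo oP kP _] := rep.
case def_sg : sg => [|x0 sg0]; first by rewrite -szo def_sg in ltx.
move: {def_sg sg0} (x0) => {}x0.
rewrite -szo in ltx; have xB : nth x0 sg x \in B by rewrite -[_ \in _]negbK -oP ?ox.
case: ifP => // known_s; case: ifP => // new_o new_b.
have [c [cH ce co cu]] := every_swap xB.
have xc : nth x0 sg x \notin c.
  by apply/negP => /cH; rewrite inE xB eqxx.
have rotc y : y \in c -> exists p, [/\ path e y (rcons p y), {subset y :: p <= c},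
    uniq (y :: p) & ~~ odd (size p)].
  move=> /rot_to[i p def_p]; exists p.
  have sub : {subset y :: p <= c} by move=> z; rewrite -def_p mem_rot.
  split=> //; first by move: ce; rewrite -(rot_cycle i) def_p.
    by rewrite -def_p rot_uniq.
  by move: co; rewrite -(size_rot i) def_p.
have subH p y : {subset y :: p <= c} -> {subset p <= beside (nth x0 sg x)}.
  by move=> yp z zp; apply/cH/yp; rewrite inE zp orbT.
have not_x p y : {subset y :: p <= c} -> nth x0 sg x \notin p.
  by move=> yp; apply: contra xc => xp; apply: yp; rewrite inE xp orbT.
have markx i : nth false (set_bit [::] x) i -> i = x.
  by rewrite /set_bit nth_set_nth /=; case: eqP; rewrite ?nth_nil.
have [/hasP[y yc yB]|/hasPn cB] := boolP (has [predC B] c).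
  have {}yB : y \notin B := yB.
  have [p [pP pc up po]] := rotc y yc; case/andP: (up) => yp up'.
  have eyx : e y (nth x0 sg x).
    by have := cH _ yc; rewrite inE (negbTE yB) e_sym.
  have [ysg|ysg] := boolP (y \in sg).
    have lts : index y sg < size sg by rewrite index_mem.
    have sE : nth x0 sg (index y sg) = y by rewrite nth_index.
    set s := index y sg in lts sE.
    have sx : ~~ nth false (set_bit [::] x) s.
      by apply/negP => /markx sx; move: yB; rewrite -sE sx /= xB.
    have lts' := lts; rewrite szo in lts'.
    have := all_unmarkedP known_s lts' sx; rewrite add0n (oP _ x0) // sE yB.
    rewrite -sE in eyx pP.
    move=> /(with_edgeP rep lts ltx eyx)[st' [rep' ext']].
    apply: (extendP ext' rep' ltx lts lts xB kabs pP (subH _ _ pc) _ up' _ po).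
      by left.
    move=> i lti; rewrite /set_bit nth_set_nth /=; case: eqP => [-> _|_].
      by rewrite sE.
    by move=> /markx->; apply: not_x pc.
  have rep_y := represents_add rep ysg (esym yB).
  have ltn : size (outer st) < size (rcons sg y) by rewrite size_rcons szo.
  have nE : nth x0 (rcons sg y) (size (outer st)) = y by rewrite nth_rcons szo ltnn eqxx.
  have ltx' : x < size (rcons sg y) by rewrite size_rcons ltnW.
  have xE : nth x0 (rcons sg y) x = nth x0 sg x by rewrite nth_rcons ltx.
  rewrite -nE in pP; rewrite -nE -xE in eyx; rewrite -xE in xB.
  have [st' [rep' ext']] := with_edgeP rep_y ltn ltx' eyx new_o.
  apply: (extendP ext' rep' ltx' ltn ltn xB kabs pP _ _ up' _ po).
  - by rewrite xE; apply: subH pc.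
  - by left.
  move=> i lti; rewrite /set_bit nth_set_nth /=; case: eqP => [-> _|_].
    by rewrite nE.
  by move=> /markx->; rewrite xE; apply: not_x pc.
have {}cB : {subset c <= B} by move=> z /cB /=; rewrite negbK.
have [known_c|unknown_c] := boolP (has (mem c) sg).
  pose s := find (mem c) sg.
  have lts : s < size sg by rewrite -has_find.
  have sc : nth x0 sg s \in c by apply: (nth_find x0 known_c).
  have [p [pP pc up po]] := rotc _ sc; case/andP: (up) => sp up'.
  have sx : ~~ nth false (set_bit [::] x) s.
    by apply/negP => /markx sx; move: xc; rewrite -sx sc.
  have lts' := lts; rewrite szo in lts'.
  have := all_unmarkedP known_s lts' sx.
  rewrite add0n (oP _ x0) // cB //= => ext'.
  apply: (extendP ext' rep ltx lts lts xB kabs pP (subH _ _ pc) _ up' _ po).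
    by right=> z zp; apply/cB/pc; rewrite inE zp orbT.
  move=> i lti; rewrite /set_bit nth_set_nth /=; case: eqP => [-> _|_].
    exact: not_x pc.
  rewrite -[true :: _]/(nseq s.+1 true) nth_nseq; case: ltnP => // le_is _.
  move: le_is; rewrite ltnS leq_eqVlt => /predU1P[->//|lt_is].
  apply/negP => ip; have := before_find x0 lt_is.
  by rewrite /= pc // inE ip orbT.
have [y yc] : exists y, y \in c.
  by case: (c) co => // y c' _; exists y; rewrite mem_head.
have [p [pP pc up po]] := rotc y yc; case/andP: (up) => yp up'.
have ysg : y \notin sg by apply: contra unknown_c => ysg; apply/hasP; exists y.
have rep_y := represents_add rep ysg (esym (negbF (cB _ yc))).
have ltn : size (outer st) < size (rcons sg y) by rewrite size_rcons szo.
have nE : nth x0 (rcons sg y) (size (outer st)) = y by rewrite nth_rcons szo ltnn eqxx.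
have ltx' : x < size (rcons sg y) by rewrite size_rcons ltnW.
have xE : nth x0 (rcons sg y) x = nth x0 sg x by rewrite nth_rcons ltx.
rewrite -nE in pP; rewrite -xE in xB.
apply: (extendP new_b rep_y ltx' ltn ltn xB kabs pP _ _ up' _ po).
- by rewrite xE; apply: subH pc.
- by right=> z zp; apply/cB/pc; rewrite inE zp orbT.
move=> i; rewrite size_rcons ltnS leq_eqVlt szo => /predU1P[->|lti] _.
  by rewrite nE.
rewrite nth_rcons szo lti; apply: contra unknown_c => ip.
by apply/hasP; exists (nth x0 sg i); rewrite ?mem_nth ?szo //= pc // inE ip orbT.
Qed.

Lemma someP f s : some f s -> exists2 x, x \in s & f x.
Proof.
elim: s => //= x s IHs; case: ifP => [fx _|_ /IHs[y ys fy]].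
  by exists x; rewrite ?mem_head.
by exists y; rewrite // inE ys orbT.
Qed.

Lemma refuteP fuel depth xs : absurd_for (refute fuel depth xs).
Proof.
elim: depth => [|d IHd] st sg rep /=; case: ifP => //.
- by move=> /someP[x _ sw] _; apply: (swapP sw rep).
- by move=> /someP[x _ sw] _; apply: (swapP sw rep).
by move=> _ /someP[x _ sw]; apply: (swapP sw rep IHd).
Qed.

Lemma refutesP fuel depth xs c : refutes fuel depth xs cap -> odd_cycle e B c -> False.
Proof.
move=> ref [cB ce co cu].
case: c => // y p in cB ce co cu; case/andP: cu => yp up.
have yB : y \in B by apply: cB; rewrite mem_head.
have rep : represents (initial_state cap) [:: y].
  split=> //; first by case=> // x0 _ /=; rewrite yB.
    by move=> i j x0; rewrite /known nth_nil nth_nil.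
  by exists set0; split; rewrite ?sub0set ?cards0 //= => q x0; rewrite inE.
have kabs : absurd_for (swap fuel 0 (refute fuel depth xs)).
  by move=> st sg rst /swapP -/(_ _ rst (@refuteP fuel depth xs)).
apply: (extendP (x0 := y) (p := p) ref rep) => //.
- move=> z zp; rewrite inE cB ?inE ?zp ?orbT //=.
  by apply: contraNneq yp => <-.
- by right=> z zp; apply: cB; rewrite inE zp orbT.
- by case.
Qed.

End Soundness.

(** * Few edges outside an independent set *)

(** The computation at the heart of the proof. The
    number 30 bounds the length of the odd cycles that are tried; the answer would
    be [false] if a longer one came up. The list holds candidates for [x] on the first
    odd cycle, the vertex 0 of which is always treated first; its order only affects
    how fast a refutation is found. *)
Lemma refutation : refutes 30 1 [:: 3; 4; 2; 5; 1; 6; 7; 8] 13.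
Proof. by vm_compute. Qed.

Definition three_colourable (T : finType) (e : rel T) : Prop :=
  exists f : T -> 'I_3, forall x y, e x y -> f x != f y.

Definition independent (T : finType) (e : rel T) (I : {set T}) : Prop :=
  {in I &, forall x y, ~~ e x y}.

Definition first_colour : 'I_3 := inord 0.
Definition other_colour (b : bool) : 'I_3 := if b then inord 1 else inord 2.

Lemma first_other b : (first_colour != other_colour b) * (other_colour b != first_colour).
Proof. by case: b; rewrite /first_colour /other_colour -!val_eqE /= !inordK. Qed.

Lemma other_colour_inj : injective other_colour.
Proof. by move=> [] [] // /eqP; rewrite /other_colour -val_eqE /= !inordK. Qed.

Section Sparse.

Variables (T : finType) (e : rel T).
Hypotheses (e_sym : symmetric e) (e_irr : irreflexive e).
Hypothesis short : short_cycle_free e.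

Lemma three_colourable_of_two (I : {set T}) :
  independent e I -> two_colourable e (~: I) -> three_colourable e.
Proof.
move=> indI [f fP]; exists (fun x => if x \in I then first_colour else other_colour (f x)).
move=> x y exy; case: ifPn => xI; case: ifPn => yI; rewrite ?first_other //.
  by rewrite (negbTE (indI _ _ xI yI)) in exy.
by rewrite (inj_eq other_colour_inj) fP ?inE.
Qed.

(** Moving [x] to the side of [I] frees exactly the outer neighbours of [x], which
    then share the two other colours with the rest of the complement of [I]. *)
Lemma three_colourable_of_swap (I : {set T}) x :
  independent e I -> x \notin I -> two_colourable e (beside e (~: I) x) ->
  three_colourable e.
Proof.
move=> indI xI [f fP].
exists (fun y => if y \in beside e (~: I) x then other_colour (f y) else first_colour).
move=> y z eyz; case: ifPn => yH; case: ifPn => zH; rewrite ?first_other //.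
  by rewrite (inj_eq other_colour_inj) fP.
exfalso; move: yH zH; rewrite !inE.
case: ifPn => yI; last first.
  move=> nxy; case: ifPn => [zI /negPn/eqP zx|zI _].
    by rewrite e_sym -zx eyz in nxy.
  have := indI y z; rewrite -(negbK (y \in I)) yI -(negbK (z \in I)) zI eyz.
  by move=> /(_ isT isT).
move=> /negPn/eqP yx; case: ifPn => [_ /negPn/eqP zx|zI].
  by rewrite yx zx e_irr in eyz.
by rewrite -yx eyz.
Qed.

(** The bound allows 13 edges outside [I]. If there is no 3-colouring, the complement
    of [I] contains an odd cycle and so does every set [beside x]; the search shows that
    13 edges are not enough for all of them. *)
Theorem three_colourable_of_few_arcs (I : {set T}) :
  independent e I -> #|arcs e (~: I)| <= 27 -> three_colourable e.
Proof.
move=> indI few; have [tw|[c cP]] := two_colourable_or_odd_cycle e_sym (~: I).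
  exact: three_colourable_of_two tw.
have [//|n3] := EM (three_colourable e); exfalso.
apply: (refutesP (cap := 13) e_sym e_irr short _ few _ refutation cP).
  by move=> x y; rewrite !inE !negbK; apply: indI.
move=> x xI; have [tw|//] := two_colourable_or_odd_cycle e_sym (beside e (~: I) x).
by case: n3; apply: three_colourable_of_swap tw; rewrite // -in_setC.
Qed.

(** The same search, run on the subgraph induced by [S] with an empty outer part:
    without outer vertices, [beside x] is just [S] without [x]. *)
Theorem odd_transversal1 (S : {set T}) : #|arcs e S| <= 27 ->
  two_colourable e S \/ exists2 x, x \in S & two_colourable e (S :\ x).
Proof.
move=> few; have [tw|[c cP]] := two_colourable_or_odd_cycle e_sym S; [by left|right].
apply: contrapT => noX.
pose eS := [rel x y | [&& x \in S, y \in S & e x y]].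
have eS_sym : symmetric eS.
  by move=> x y; rewrite /= e_sym; case: (x \in S); case: (y \in S).
have eS_irr : irreflexive eS by move=> x /=; rewrite e_irr !andbF.
have eSe x y : eS x y -> e x y by move=> /and3P[].
have shortS : short_cycle_free eS.
  have [C3 C4 C5] := short; have notS x y : ~~ e x y -> ~~ eS x y.
    exact/contra/eSe.
  split=> [x y z /eSe e1 /eSe e2|x y z w nxz nyw /eSe e1 /eSe e2 /eSe e3|].
  - exact/notS/C3/e2.
  - exact/notS/(C4 _ _ _ _ nxz nyw e1 e2 e3).
  - move=> x y z w v /eSe e1 /eSe e2 /eSe e3 /eSe e4.
    exact/notS/(C5 _ _ _ _ _ e1 e2 e3 e4).
have arcsS : arcs eS S = arcs e S.
  by apply/setP => -[x y]; rewrite !inE /=; case: (x \in S); case: (y \in S).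
apply: (refutesP (B := S) (cap := 13) eS_sym eS_irr shortS _ _ _ refutation (c := c)).
- by move=> x y xS _; rewrite /= (negbTE xS).
- by rewrite arcsS.
- move=> x xS; have [tw|//] := two_colourable_or_odd_cycle eS_sym (beside eS S x).
  case: noX; exists x => //; case: tw => f fP; exists f => y z.
  rewrite !inE => /andP[nyx yS] /andP[nzx zS] eyz.
  by apply: fP; rewrite ?inE ?yS ?zS ?nyx ?nzx //= yS zS.
have [cS ce co cu] := cP; split=> //.
apply/(sub_in_cycle (P := mem S)): ce; last exact/allP.
by move=> x y xS yS exy; apply/and3P.
Qed.

End Sparse.

(** * Degrees around a vertex *)

Section Counting.

Variables (T : finType) (e : rel T).
Hypotheses (e_sym : symmetric e) (e_irr : irreflexive e).
Hypothesis short : short_cycle_free e.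

Definition nb (x : T) : {set T} := [set y | e x y].
Definition deg (x : T) : nat := #|nb x|.
Definition nb2 (x : T) : {set T} :=
  [set y | (y != x) && [exists u, e x u && e u y]].
Definition far (x : T) : {set T} := ~: (x |: (nb x :|: nb2 x)).

Lemma degE x : deg x = \sum_y e x y.
Proof.
rewrite /deg /nb -sum1dep_card [RHS](bigID (e x)) /= [X in _ + X]big1.
  by rewrite addn0; apply: eq_bigr => y ->.
by move=> y /negbTE->.
Qed.

Lemma arcsE (S : {set T}) : #|arcs e S| = \sum_(x in S) \sum_(y in S) e x y.
Proof.
rewrite pair_big /= -sum1_card big_mkcond [RHS]big_mkcond; apply: eq_bigr => -[x y] _.
by rewrite inE /= andbA; case: ((x \in S) && (y \in S)); case: (e x y).
Qed.

Lemma arcs_setC (I : {set T}) : independent e I ->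
  #|arcs e (~: I)| + 2 * \sum_(x in I) deg x = \sum_x deg x.
Proof.
move=> indI; rewrite arcsE.
have inI x : x \in I -> deg x = \sum_(y in ~: I) e x y.
  move=> xI; rewrite degE (bigID (mem I)) /= big1 ?add0n.
    by apply: eq_bigl => y; rewrite inE.
  by move=> y yI; rewrite (negbTE (indI _ _ xI yI)).
rewrite [RHS](bigID (mem I)) /= mul2n -addnn addnCA; congr (_ + _).
rewrite [RHS](eq_bigl (fun y => y \in ~: I)) => [|y]; last by rewrite in_setC.
rewrite [X in _ + X](eq_bigr _ inI) [X in _ + X]exchange_big /= -big_split /=.
apply: eq_bigr => x _; rewrite degE [RHS](bigID (mem I)) /= addnC.
congr (_ + _); first by apply: eq_bigr => y _; rewrite e_sym.
by apply: eq_bigl => y; rewrite inE.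
Qed.

Lemma arcs_subset (A S : {set T}) : A \subset S -> arcs e A \subset arcs e S.
Proof.
move=> /subsetP AS; apply/subsetP => -[x y].
by rewrite !inE /= => /and3P[/AS-> /AS-> ->].
Qed.

Lemma arcs_setD1 (S : {set T}) x : x \in S ->
  #|arcs e S| = #|arcs e (S :\ x)| + 2 * #|nb x :&: S|.
Proof.
move=> xS; rewrite !arcsE (big_setD1 x) //=.
have nbE : \sum_(y in S) e x y = #|nb x :&: S|.
  rewrite -sum1_card [RHS]big_mkcond [LHS]big_mkcond /=; apply: eq_bigr => y _.
  by rewrite !inE andbC; case: (y \in S); case: (e x y).
have nbE' : \sum_(y in S :\ x) e y x = #|nb x :&: S|.
  rewrite -nbE [RHS](big_setD1 x) //= e_irr add0n.
  by apply: eq_bigr => y _; rewrite e_sym.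
rewrite nbE [X in _ + X = _](eq_bigr (fun y => e y x + \sum_(z in S :\ x) e y z)).
  by rewrite big_split /= nbE'; lia.
by move=> y _; rewrite (big_setD1 x).
Qed.

(** Without 4-cycles a vertex other than [v] is reached by at most one path of length 2
    from [v], so only [v] itself is counted with a multiplicity. *)
Lemma sum_nb_nb (F : T -> nat) v :
  \sum_(u in nb v) \sum_(y in nb u) F y = deg v * F v + \sum_(y in nb2 v) F y.
Proof.
have -> : \sum_(u in nb v) \sum_(y in nb u) F y =
          \sum_y #|nb v :&: nb y| * F y.
  under eq_bigr => u _ do rewrite big_mkcond.
  rewrite exchange_big /=; apply: eq_bigr => y _.
  rewrite -sum_nat_const [RHS]big_mkcond [LHS]big_mkcond; apply: eq_bigr => u _.
  by rewrite !inE (e_sym y); case: (e v u); case: (e u y).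
rewrite (bigD1 v) //= setIid; congr (_ + _).
rewrite [RHS](eq_bigl (fun y => (y != v) && (y \in nb2 v))); last first.
  by move=> y; rewrite !inE; case: eqP.
rewrite [LHS](bigID (mem (nb2 v))) /= [X in _ + X]big1 ?addn0 => [|y].
  apply: eq_bigr => y /andP[nyv]; rewrite inE nyv /= => /existsP[u /andP[evu euy]].
  suff -> : nb v :&: nb y = [set u] by rewrite cards1 mul1n.
  apply/setP => w; rewrite !inE; apply/andP/eqP => [[evw eyw]|->]; last first.
    by rewrite e_sym in euy.
  apply/eqP; apply: contraT => nwu; have [_ C4 _] := short.
  have := C4 v u y w _ _ evu euy eyw; rewrite eq_sym nyv eq_sym nwu e_sym evw.
  by move=> /(_ isT isT).
move=> /andP[nyv]; rewrite inE nyv /= => /existsPn no; apply/eqP.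
rewrite muln_eq0 cards_eq0; apply/orP; left; apply/eqP/setP => u.
by rewrite !inE (e_sym y); apply/negbTE.
Qed.

Lemma sum_nb_sym (F G : T -> nat) :
  \sum_v F v * (\sum_(u in nb v) G u) = \sum_u G u * (\sum_(v in nb u) F v).
Proof.
under eq_bigr => v _ do rewrite big_distrr /= big_mkcond.
under [RHS]eq_bigr => v _ do rewrite big_distrr /= big_mkcond.
rewrite exchange_big; apply: eq_bigr => u _; apply: eq_bigr => v _ /=.
by rewrite !inE e_sym mulnC.
Qed.

Lemma indep_nb v : independent e (nb v).
Proof.
have [C3 _ _] := short; move=> x y; rewrite !inE => evx evy.
by apply/negP => exy; have := C3 _ _ _ evx exy; rewrite e_sym evy.
Qed.

Lemma nb2P v y : y \in nb2 v -> exists2 u, e v u & e u y.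
Proof. by rewrite inE => /andP[_ /existsP[u /andP[]]]; exists u. Qed.

Lemma not_e_nb2 v y : y \in nb2 v -> ~~ e v y.
Proof.
have [C3 _ _] := short; move=> /nb2P[u evu euy].
by rewrite e_sym; apply: C3 evu euy.
Qed.

Lemma indep_nb2 v : independent e (v |: nb2 v).
Proof.
have [_ _ C5] := short.
move=> x y /setU1P[->|xN] /setU1P[->|yN]; first by rewrite e_irr.
- exact: not_e_nb2.
- by rewrite e_sym; apply: not_e_nb2.
have [[u evu eux] [w evw ewy]] := (nb2P xN, nb2P yN).
apply/negP => exy; have := C5 v u x y w evu eux exy.
by rewrite (e_sym y) ewy (e_sym w) evw => /(_ isT).
Qed.

Lemma sum_levels (F : T -> nat) v :
  \sum_x F x = F v + \sum_(x in nb v) F x + \sum_(x in nb2 v) F x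
               + \sum_(x in far v) F x.
Proof.
rewrite (bigID (mem (v |: (nb v :|: nb2 v)))) /=.
rewrite [X in _ + X = _](eq_bigl (fun y => y \in far v)).
  congr (_ + _); rewrite big_setU1 /=; last by rewrite !inE e_irr eqxx.
  rewrite (big_setID (nb v)) /= addnA; congr (_ + _ + _).
    by apply: eq_bigl => x; rewrite !inE; case: (e v x); rewrite ?andbF.
  apply: eq_bigl => x; rewrite in_setD in_setU.
  have := @not_e_nb2 v x; rewrite [x \in nb v]inE.
  by case: (x \in nb2 v) => [->|] //; case: (e v x).
by move=> x; rewrite [in RHS]inE.
Qed.

Lemma not_e_nb_far v x y : x \in nb v -> y \in far v -> ~~ e x y.
Proof.
rewrite !inE !negb_or => evx /and3P[nyv nvy /nandP[|/existsPn no]].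
  by rewrite nyv.
by apply/negP => exy; have := no x; rewrite evx exy.
Qed.


(** * Deleting vertices from odd cycles *)

Lemma odd_cycle_size (S : {set T}) c : odd_cycle e S c -> 6 < size c.
Proof.
have [C3 C4 C5] := short; move=> [_ ce co _].
case: c ce co => [|a [|b [|c [|d [|f [|g [|l q]]]]]]] //=.
- by rewrite e_irr.
- by move=> /and4P[ab bc ca _] _; have := C3 _ _ _ ab bc; rewrite ca.
- move=> /and5P[ab bc cd df /andP[fa _]] _.
  by have := C5 _ _ _ _ _ ab bc cd df; rewrite fa.
Qed.

Lemma odd_cycle_deg (S : {set T}) c x : odd_cycle e S c -> x \in c ->
  1 < #|nb x :&: S|.
Proof.
move=> oc xc; have sc := odd_cycle_size oc; have [cS ce _ cu] := oc.
have [i p def_p] := rot_to xc.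
have pS : {subset x :: p <= S} by move=> z; rewrite -def_p mem_rot; apply: cS.
move: ce cu sc; rewrite -(rot_cycle i) -(rot_uniq i) -(size_rot i) def_p.
case: p pS {def_p} => [|y p] // pS; case/lastP: p pS => [|p z] // pS.
rewrite /= rcons_path last_rcons => /and3P[exy _ ezx] /and3P[_ yp _] _.
apply: (@leq_trans #|[set y; z]|).
  rewrite cards2 (_ : y != z) //; apply: contraNneq yp => ->.
  by rewrite mem_rcons mem_head.
apply/subset_leq_card/subsetP => w /set2P[]->; rewrite !inE pS ?andbT //.
- by rewrite !inE eqxx orbT.
- by rewrite e_sym.
- by rewrite !inE mem_rcons mem_head !orbT.
Qed.

Definition exc (x : T) : nat := deg x - 3.
Definition deg_sum : nat := \sum_x deg x.
Definition exc_sum : nat := \sum_x exc x.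
Definition exc_nb (x : T) : nat := \sum_(y in nb x) exc y.
Definition exc_nb_nb (x : T) : nat := \sum_(y in nb x) exc_nb y.

(** Delete vertices from odd cycles one at a time. Each of the first [k] deletions
    removes two edges of the cycle, that is 4 arcs, and [odd_transversal1] ends the
    process with one vertex of degree at most [Delta]. If the vertices of [S]
    exceed degree 3 by at most 6 in total, an odd cycle, which has at least 7
    vertices, contains one of degree 3 to delete. *)
Lemma odd_transversal c Delta k (S : {set T}) :
    (forall x, deg x <= Delta) -> Delta <= c \/ 3 <= c /\ \sum_(x in S) exc x <= 6 ->
    #|arcs e S| <= 27 + 4 * k ->
  exists2 Z : {set T}, two_colourable e (S :\: Z) &
    \sum_(x in Z) deg x <= c * k + Delta.
Proof.
move=> degDelta; elim: k S => [|k IHk] S cS few.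
  rewrite muln0 addn0 in few.
  have [tw|[x xS tw]] := odd_transversal1 e_sym e_irr short few.
    by exists set0; rewrite ?setD0 ?big_set0.
  by exists [set x]; rewrite // big_set1 muln0 degDelta.
have [tw|[w wP]] := two_colourable_or_odd_cycle e_sym S.
  by exists set0; rewrite ?setD0 ?big_set0.
have w7 := odd_cycle_size wP; have [wS we wo wu] := wP.
have [x xw dx] : exists2 x, x \in w & deg x <= c.
  case: cS => [Deltac|[c3 S6]].
    case: (w) w7 => // x w' _; exists x; first exact: mem_head.
    exact: leq_trans (degDelta x) Deltac.
  apply: contrapT => no; move: w7; rewrite ltnNge => /negP; apply.
  apply: leq_trans S6; rewrite -sum1_size big_tnth /=.
  rewrite -(big_tnth _ _ _ predT (fun=> 1)) big_uniq //=.
  rewrite big_mkcond [X in _ <= X]big_mkcond; apply: leq_sum => x _ /=.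
  case: ifP => // xw; rewrite wS // subn_gt0 ltnNge; apply/negP => dx.
  by apply: no; exists x => //; apply: leq_trans c3.
have xS := wS _ xw; have nx := odd_cycle_deg wP xw.
have [||Z twZ sumZ] := IHk (S :\ x).
- case: cS => [|[c3 S6]]; [by left|right; split=> //].
  by apply: leq_trans S6; rewrite [X in _ <= X](big_setD1 x) //= leq_addl.
- by move: few; rewrite (arcs_setD1 xS); lia.
exists (x |: Z); first by rewrite -setDDl.
have [xZ|xZ] := boolP (x \in Z).
  rewrite (setUidPr _) ?sub1set //; apply: leq_trans sumZ _.
  by rewrite leq_add2r leq_mul2l leqnSn orbT.
by rewrite big_setU1 //= mulnS -addnA leq_add.
Qed.

(** * The bounds that a non-3-colourable graph satisfies *)

Hypothesis n28 : #|T| <= 28.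
Hypothesis deg3 : forall x, 3 <= deg x.
Hypothesis not3 : ~ three_colourable e.

Lemma degX x : deg x = 3 + exc x.
Proof. by rewrite /exc subnKC. Qed.

Lemma sum_degX (S : {set T}) : \sum_(x in S) deg x = 3 * #|S| + \sum_(x in S) exc x.
Proof.
by under eq_bigr => x _ do rewrite degX; rewrite big_split /= sum_nat_const mulnC.
Qed.

Lemma deg_sumE : deg_sum = 3 * #|T| + exc_sum.
Proof.
by rewrite /deg_sum /exc_sum; under eq_bigr => x _ do rewrite degX;
   rewrite big_split /= sum_nat_const mulnC.
Qed.

(** [three_colourable_of_few_arcs] in terms of degrees: at least 14 edges avoid [I]. *)
Lemma independent_bound (I : {set T}) : independent e I ->
  2 * \sum_(x in I) deg x + 28 <= deg_sum.
Proof.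
move=> indI; rewrite /deg_sum -(arcs_setC indI) addnC leq_add2r ltnNge.
by apply/negP => few; apply: not3; apply: three_colourable_of_few_arcs few.
Qed.

Lemma deg_nb v : \sum_(x in nb v) deg x = 3 * deg v + exc_nb v.
Proof. exact: sum_degX. Qed.

Lemma deg_nb2 v :
  \sum_(x in nb2 v) deg x + deg v ^ 2 = 9 * deg v + 3 * exc_nb v + exc_nb_nb v.
Proof.
rewrite addnC expnS expn1 -sum_nb_nb.
under eq_bigr => u _ do rewrite deg_nb degX mulnDr.
rewrite !big_split /= sum_nat_const big1_eq.
by rewrite -/(exc_nb v) -/(exc_nb_nb v) -/(deg v); lia.
Qed.

Lemma exc_nb2 v : \sum_(x in nb2 v) exc x + deg v * exc v = exc_nb_nb v.
Proof. by rewrite addnC -sum_nb_nb. Qed.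

(** [independent_bound] for [v] together with its second neighbours, a set that is
    independent because there are no cycles of length 3 and 5. *)
Lemma nb2_bound v :
  2 * (10 * deg v + 3 * exc_nb v + exc_nb_nb v) + 28 <= deg_sum + 2 * deg v ^ 2.
Proof.
have := independent_bound (indep_nb2 (v := v)).
rewrite big_setU1 /=; last by rewrite !inE eqxx.
by have := deg_nb2 v; lia.
Qed.

Lemma arcs_far v :
  #|arcs e (far v)| + 2 * (10 * deg v + 3 * exc_nb v + exc_nb_nb v)
    <= deg_sum + 2 * deg v ^ 2.
Proof.
have := arcs_setC (indep_nb2 (v := v)).
rewrite big_setU1 /=; last by rewrite !inE eqxx.
rewrite -/deg_sum; have := deg_nb2 v.
have : arcs e (far v) \subset arcs e (~: (v |: nb2 v)).
  by apply: arcs_subset; rewrite setCS setUS // subsetUr.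
by move/subset_leq_card; move: #|_| #|_| => a b; lia.
Qed.

(** [independent_bound] for the neighbours of [v] together with the heavier colour class
    of [far v] without [Z]. *)
Lemma transversal_bound v (Z : {set T}) : two_colourable e (far v :\: Z) ->
  28 + deg v ^ 2 <= 7 * deg v + 2 * exc_nb v + exc_nb_nb v + \sum_(x in Z) deg x.
Proof.
move=> [f fP]; pose J b := [set x in far v :\: Z | f x == b].
have indJ b : independent e (nb v :|: J b).
  move=> x y /setUP[xn|xJ] /setUP[yn|yJ].
  - exact: (@indep_nb v).
  - by apply: (@not_e_nb_far v) => //; move: yJ; rewrite !inE => /andP[/andP[_ ->]].
  - rewrite e_sym; apply: (@not_e_nb_far v) => //.
    by move: xJ; rewrite !inE => /andP[/andP[_ ->]].
  move: xJ yJ; rewrite !inE => /andP[xf /eqP fx] /andP[yf /eqP fy].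
  by apply/negP => /fP; rewrite fx fy eqxx !inE xf yf => /(_ isT isT).
have sumJ b : \sum_(x in nb v :|: J b) deg x =
    \sum_(x in nb v) deg x + \sum_(x in J b) deg x.
  rewrite (big_setID (nb v)) /= setUK setDUl setDv set0U; congr (_ + _).
  apply: eq_bigl => x; rewrite in_setD.
  have [xJ|_] := boolP (x \in J b); last by rewrite andbF.
  rewrite andbT; apply/negP; move: xJ; rewrite !inE => /andP[/andP[_]].
  by rewrite !negb_or => /and3P[_ /negP].
have far_le : \sum_(x in far v) deg x <=
    \sum_(x in J true) deg x + \sum_(x in J false) deg x + \sum_(x in Z) deg x.
  rewrite (big_setID Z) /= addnC leq_add //.
    rewrite (big_setID (J true)) /= leq_add //.
      apply: eq_leq; apply: eq_bigl => x; rewrite [x \in J true]inE in_setI.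
      by rewrite [x \in J true]inE andbA andbb.
    apply: eq_leq; apply: eq_bigl => x; rewrite in_setD ![x \in J _]inE.
    by case: (x \in _ :\: _); case: (f x).
  by rewrite [X in _ <= X](big_setID (far v)) /= setIC leq_addr.
have [iT iF] := (independent_bound (indJ true), independent_bound (indJ false)).
have := sum_levels deg v; rewrite -/deg_sum; move: iT iF far_le (deg_nb v) (deg_nb2 v).
by rewrite !sumJ; lia.
Qed.

Lemma card_levels v : 1 + 3 * deg v + exc_nb v <= #|T|.
Proof.
have := sum_levels (fun=> 1) v; rewrite !sum1_card -/(deg v).
have := sum_nb_nb (fun=> 1) v; rewrite sum1_card.
under eq_bigr => u _ do rewrite sum1_card -/(deg u).
have -> : #|xpredT : pred T| = #|T| by apply: eq_card.
by rewrite deg_nb; lia.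
Qed.

Lemma sum_exc_nb : \sum_x exc_nb x = \sum_x exc x * deg x.
Proof.
have := sum_nb_sym (fun=> 1) exc; under eq_bigr => v _ do rewrite mul1n.
by move=> ->; apply: eq_bigr => x _; rewrite sum1_card.
Qed.

Lemma sum_exc_nb_nb : \sum_x exc x * exc_nb_nb x = \sum_x exc_nb x ^ 2.
Proof. by rewrite /exc_nb_nb sum_nb_sym. Qed.

(** * The total excess is at most 10 *)

Lemma exc_le6 v : exc v <= 6.
Proof. by have := card_levels v; have := n28; rewrite degX; lia. Qed.

(** The sums below are brought to the right-nested shape that this rule splits, whence
    their factors 1 and summands 0. *)
Lemma sum_lin (a : nat) (F G : T -> nat) :
  \sum_x (a * F x + G x) = a * \sum_x F x + \sum_x G x.
Proof. by rewrite big_split big_distrr. Qed.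

Lemma sum_const c : \sum_(x : T) c = c * #|T|.
Proof. by rewrite sum_nat_const mulnC. Qed.

(** [nb2_bound] summed over all [v] with weight [exc v]. The weighted sum of [exc_nb_nb]
    becomes the sum of the squares of [exc_nb]. *)
Lemma weighted_bound :
  70 * exc_sum + (8 * (\sum_x exc x ^ 2) + (6 * (\sum_x exc x * exc_nb x)
    + 2 * (\sum_x exc_nb x ^ 2))) <= deg_sum * exc_sum + 2 * (\sum_x exc x ^ 3).
Proof.
have pt v : 70 * exc v + (8 * exc v ^ 2 + (6 * (exc v * exc_nb v)
    + 2 * (exc v * exc_nb_nb v))) <= deg_sum * exc v + 2 * exc v ^ 3.
  have := nb2_bound v; rewrite degX.
  move: (exc v) (exc_nb v) (exc_nb_nb v) deg_sum => x a b d.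
  by rewrite !expnS !expn0; clear; nia.
have := @leq_sum _ (index_enum T) xpredT _ _ (fun v _ => pt v).
by do 4 rewrite sum_lin; rewrite -!big_distrr sum_exc_nb_nb.
Qed.

(** For an integer [y] and any [a], the product of [y - a] and [y - a - 1] is not
    negative. So [weighted_bound] can be made linear with [b = 2a + 1] and
    [m = a (a + 1)]; the number [c] is the largest that [x = 1] allows.
    Here [x] stands for [exc v] and [y] for [exc_nb v]. *)
Lemma quadratic_sum b c m :
    (forall x y, x <= 6 ->
      b * y + (c * x + x ^ 3) <=
      3 * (x * y) + (4 * x ^ 2 + (b * (x * (3 + x)) + (1 * y ^ 2 + m)))) ->
  (70 + 2 * c) * exc_sum <= deg_sum * exc_sum + 2 * (m * #|T|).
Proof.
move=> pt; have := @leq_sum _ (index_enum T) xpredT _ _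
  (fun v _ => pt (exc v) (exc_nb v) (exc_le6 v)).
do 6 rewrite sum_lin.
under [X in _ <= _ + (_ + (b * X + _))]eq_bigr => v _ do rewrite -degX.
rewrite -sum_exc_nb -/exc_sum sum_const.
by have := weighted_bound; lia.
Qed.

Lemma exc_sum_le62 : exc_sum <= 62.
Proof.
have pt v : 3 * exc v + (1 * exc_nb v + 10) <= #|T|.
  by have := card_levels v; rewrite degX; lia.
have := @leq_sum _ (index_enum T) xpredT _ _ (fun v _ => pt v).
do 2 rewrite sum_lin; rewrite !sum_const sum_exc_nb -/exc_sum.
have pt2 v : 6 * exc v <= 1 * (exc v * deg v) + 2.
  by rewrite degX; move: (exc v) => [|[|x]] //; clear; nia.
have := @leq_sum _ (index_enum T) xpredT _ _ (fun v _ => pt2 v).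
rewrite sum_lin -big_distrr sum_const /= -/exc_sum.
by move: #|T| (\sum_x _) exc_sum n28 => n s x; clear; nia.
Qed.

Lemma between_roots lo hi x : lo <= x <= hi -> x * x + lo * hi <= (lo + hi) * x.
Proof.
move=> /andP[/subnKC <- /subnKC <-]; move: (x - lo) (hi - _) => k j.
by clear; nia.
Qed.

(** With [s] for [exc_sum], [quadratic_sum] reads [126 s <= 84 s + s^2 + 336] for
    [a = 2] and 28 vertices, which fails between 11 and 31. The choices [a = 3] and
    [a = 4] settle the values up to 49 and up to 62. *)
Lemma exc_sum_le10 : exc_sum <= 10.
Proof.
have n0 := n28; have DE' := deg_sumE; have E62 := exc_sum_le62.
have nE : #|T| * exc_sum <= 28 * exc_sum by rewrite leq_mul2r n0 orbT.
rewrite leqNgt; apply/negP => E11.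
have [E31|E31] := leqP exc_sum 31.
  suff pt : forall x y, x <= 6 -> 5 * y + (28 * x + x ^ 3) <=
      3 * (x * y) + (4 * x ^ 2 + (5 * (x * (3 + x)) + (1 * y ^ 2 + 6))).
    have := quadratic_sum pt; rewrite DE'.
    have := @between_roots 11 31 exc_sum; rewrite E11 E31; lia.
  move=> x y x6; have := leqP y 2; case; have := leqP y 1; case;
    rewrite !expnS !expn0;
    by do 7?[case: x x6 => [|x] x6 //]; clear; nia.
have [E49|E49] := leqP exc_sum 49.
  suff pt : forall x y, x <= 6 -> 7 * y + (39 * x + x ^ 3) <=
      3 * (x * y) + (4 * x ^ 2 + (7 * (x * (3 + x)) + (1 * y ^ 2 + 12))).
    have := quadratic_sum pt; rewrite DE'.
    have := @between_roots 32 49 exc_sum; rewrite E31 E49; lia.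
  move=> x y x6; have := leqP y 3; case; have := leqP y 2; case;
    rewrite !expnS !expn0;
    by do 7?[case: x x6 => [|x] x6 //]; clear; nia.
suff pt : forall x y, x <= 6 -> 9 * y + (50 * x + x ^ 3) <=
    3 * (x * y) + (4 * x ^ 2 + (9 * (x * (3 + x)) + (1 * y ^ 2 + 20))).
  have := quadratic_sum pt; rewrite DE'.
  have := @between_roots 50 62 exc_sum; rewrite E49 E62; lia.
move=> x y x6; have := leqP y 4; case; have := leqP y 3; case;
    rewrite !expnS !expn0;
  by do 7?[case: x x6 => [|x] x6 //]; clear; nia.
Qed.

(** * Small total excess *)

Lemma deg_sum_le94 : deg_sum <= 94.
Proof. by have := deg_sumE; have := exc_sum_le10; have := n28; lia. Qed.

Lemma exc_le1 v : exc v <= 1.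
Proof.
have := nb2_bound v; have := exc_nb2 v; have := deg_sum_le94; rewrite degX.
move: (exc v) (exc_nb v) (exc_nb_nb v) deg_sum (\sum_(x in _) _) => x a b d s.
by rewrite !expnS !expn0; clear; nia.
Qed.

Lemma deg_le4 v : deg v <= 4.
Proof. by rewrite degX ltnS ltnS; have := exc_le1 v; lia. Qed.

Section HighVertex.

Variable v : T.
Hypothesis v1 : exc v = 1.

Lemma high_bound : 76 + 6 * exc_nb v + 2 * exc_nb_nb v <= deg_sum.
Proof. by have := nb2_bound v; rewrite degX v1; lia. Qed.

Lemma high_nb_nb : 4 <= exc_nb_nb v.
Proof. by have := exc_nb2 v; rewrite degX v1; lia. Qed.

Lemma high_far : \sum_(x in far v) exc x + exc_nb v + exc_nb_nb v = exc_sum + 3.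
Proof.
have := exc_nb2 v; have := sum_levels exc v; rewrite degX v1 -/exc_sum -/(exc_nb v).
by have := high_nb_nb; lia.
Qed.

(** [transversal_bound] for the set that [odd_transversal] finds in [far v], after [k]
    deletions of vertices of degree at most [c]. By [high_far] the second
    alternative leaves an excess of at most 6 to [far v], so [c = 3] is possible. The
    last vertex, of degree at most 4, turns the 16 of [transversal_bound] into 12. *)
Lemma high_transversal c k :
    4 <= c \/ 3 <= c /\ exc_sum <= 3 + exc_nb v + exc_nb_nb v ->
    deg_sum <= 75 + 4 * k + 6 * exc_nb v + 2 * exc_nb_nb v ->
  12 <= 2 * exc_nb v + exc_nb_nb v + c * k.
Proof.
move=> cP Dk; have [||Z twZ sumZ] := @odd_transversal c 4 k (far v) deg_le4.
- by case: cP => [|[c3 Eh]]; [left|right; split=> //]; have := high_far; lia.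
- by have := arcs_far v; rewrite degX v1; lia.
by have := transversal_bound twZ; rewrite degX v1; lia.
Qed.

End HighVertex.

Lemma high_sum b (F : T -> nat) : (forall v, exc v = 1 -> F v <= b) ->
  \sum_x exc x * F x <= b * exc_sum.
Proof.
move=> Fb; rewrite /exc_sum big_distrr /=; apply: leq_sum => v _.
have := exc_le1 v; case def_x: (exc v) => [|[|//]] _ //.
by rewrite mul1n muln1 Fb.
Qed.

Lemma sum_excX : \sum_x exc x * deg x = 4 * exc_sum.
Proof.
rewrite /exc_sum big_distrr; apply: eq_bigr => v _ /=; rewrite degX.
by have := exc_le1 v; case: (exc v) => [|[|]].
Qed.

(** Any vertex of degree 4 gives a contradiction. By [arcs_far] its far part has at most
    17 edges, which calls for two deletions. If [3 * exc_nb v + exc_nb_nb v] exceeds 5,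
    these are at most 15 edges and one deletion is enough. *)
Lemma exc_sum_gt7 : 0 < exc_sum -> 7 < exc_sum.
Proof.
move=> E0; have [v v1] : exists v, exc v = 1.
  apply: contrapT => no; move: E0; rewrite /exc_sum big1 // => v _.
  by have := exc_le1 v; case def_x: (exc v) => [|[|]] // _; case: no; exists v.
rewrite ltnNge; apply/negP => E7.
have D91 : deg_sum <= 91 by have := deg_sumE; have := n28; lia.
have := high_bound v1; have := high_nb_nb v1.
have [hb|hb] := leqP (3 * exc_nb v + exc_nb_nb v) 5.
  by have := @high_transversal v v1 3 2; lia.
by have := @high_transversal v v1 3 1; lia.
Qed.

(** Each vertex of degree 4 satisfies [b6], but the average of the left side of [b6] over
    these vertices is too large for that. *)
Lemma exc_sum_gt9 : 7 < exc_sum -> 9 < exc_sum.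
Proof.
move=> E8; rewrite ltnNge; apply/negP => E9.
have D93 : deg_sum <= 93 by have := deg_sumE; have := n28; lia.
have b6 v : exc v = 1 -> 3 * exc_nb v + (1 * exc_nb_nb v + 0) <= 6.
  move=> v1; have := high_bound v1; have := high_nb_nb v1; rewrite leqNgt => hh4 hb.
  apply/negP => b7.
  (* One deletion suffices beyond the bound: of a vertex of degree 3 if the excess of
     the far part allows it, and of an arbitrary vertex of an odd cycle otherwise. *)
  have := @high_transversal v v1 4 1; have := @high_transversal v v1 3 1.
  by case: (exc_nb v) b7 hb => [|x] b7 hb; lia.
have := high_sum b6.
have -> : \sum_x exc x * (3 * exc_nb x + (1 * exc_nb_nb x + 0)) =
    3 * (\sum_x exc x * exc_nb x) + \sum_x exc_nb x ^ 2.
  rewrite -sum_exc_nb_nb -sum_lin; apply: eq_bigr => v _; lia.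
have pt v : 3 * exc_nb v + 2 * exc v <= 3 * (exc v * exc_nb v) + (1 * exc_nb v ^ 2 + 2).
  case: (exc v) (exc_le1 v) => [|[|//]] _; rewrite !expnS !expn0;
    case: (exc_nb v) => [|[|y]]; clear; nia.
have := @leq_sum _ (index_enum T) xpredT _ _ (fun v _ => pt v).
do 3 rewrite sum_lin; rewrite -big_distrr sum_const /= -/exc_sum.
rewrite sum_exc_nb sum_excX; move: n28.
by move: #|T| (\sum_x exc x * exc_nb x) (\sum_x exc_nb x ^ 2) => n s q; lia.
Qed.

(** The same average argument for total excess 10. The slope 5 in place of 3 records that
    a vertex of degree 4 with a neighbour of degree 4 satisfies a better bound. *)
Lemma exc_sum_eq0 : exc_sum = 0.
Proof.
apply/eqP; rewrite -leqn0 leqNgt; apply/negP => E0.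
have E10 : exc_sum = 10.
  by have := exc_sum_le10; have := exc_sum_gt9 (exc_sum_gt7 E0); lia.
have D94 := deg_sum_le94.
have b9 v : exc v = 1 -> 5 * exc_nb v + (1 * exc_nb_nb v + 0) <= 9.
  move=> v1; have := high_bound v1; have := high_nb_nb v1 => hh4 hb.
  (* One deletion suffices beyond the bound: of a vertex of degree 3 if the excess of
     the far part allows it, and of an arbitrary vertex of an odd cycle otherwise. *)
  have := @high_transversal v v1 4 1; have := @high_transversal v v1 3 1.
  by case: (exc_nb v) hb => [|[|x]] hb; lia.
have := high_sum b9.
have -> : \sum_x exc x * (5 * exc_nb x + (1 * exc_nb_nb x + 0)) =
    5 * (\sum_x exc x * exc_nb x) + \sum_x exc_nb x ^ 2.
  rewrite -sum_exc_nb_nb -sum_lin; apply: eq_bigr => v _; lia.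
have pt v : 5 * exc_nb v + 6 * exc v <= 5 * (exc v * exc_nb v) + (1 * exc_nb v ^ 2 + 6).
  case: (exc v) (exc_le1 v) => [|[|//]] _; rewrite !expnS !expn0;
    case: (exc_nb v) => [|[|[|y]]]; clear; nia.
have := @leq_sum _ (index_enum T) xpredT _ _ (fun v _ => pt v).
do 3 rewrite sum_lin; rewrite -big_distrr sum_const /= -/exc_sum.
rewrite sum_exc_nb sum_excX; move: n28.
by move: #|T| (\sum_x exc x * exc_nb x) (\sum_x exc_nb x ^ 2) => n s q; lia.
Qed.

(** In a cubic graph on at most 28 vertices the far part of a vertex has at most 21
    edges: four deletions and the last vertex have total degree 15, one less than
    [transversal_bound] asks for. *)
Lemma counting_contradiction : False.
Proof.
have exc0 x : exc x = 0.
  by apply/eqP; rewrite -leqn0 -exc_sum_eq0 /exc_sum (bigD1 x) //= leq_addr.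
have d3 x : deg x = 3 by rewrite degX exc0.
have h0 x : exc_nb x = 0 by rewrite /exc_nb big1.
have hh0 x : exc_nb_nb x = 0 by rewrite /exc_nb_nb big1.
have [v _|T0] := pickP (@predT T); last first.
  by apply: not3; exists (fun=> first_colour) => x; have := T0 x.
have [|||Z twZ sumZ] := @odd_transversal 3 3 4 (far v).
- by move=> x; rewrite d3.
- by left.
- have := arcs_far v; have := deg_sumE; have := n28.
  by rewrite exc_sum_eq0 d3 h0 hh0; lia.
by have := transversal_bound twZ; rewrite d3 h0 hh0; lia.
Qed.

End Counting.

(** * Girth, and reduction to minimal graphs *)

Lemma min_natP (P : pred nat) : (exists n, P n) ->
  exists m, [/\ min_nat P = Some m, P m & forall n, P n -> m <= n].
Proof.
move=> exP; rewrite /min_nat; case: pselect => // exP'.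
by exists (ex_minn exP'); split=> //; case: ex_minnP.
Qed.

Lemma girth_at_leastP g (G : sgraph) :
  girth_at_least g G <-> forall n, has_cycle G n -> g <= n.
Proof.
rewrite /girth_at_least /girth.
have [ex|no] := EM (exists n, has_cycle G n).
  have [m [-> Pm minm]] := min_natP ex.
  by split=> [gm n /minm|]; [exact: leq_trans gm | exact].
rewrite /min_nat; case: pselect => // _.
by split=> // _ n Gn; case: no; exists n.
Qed.

Lemma has_cycleP (G : sgraph) (c : seq G) :
  2 < size c -> cycle (@adj G) c -> uniq c -> has_cycle G (size c).
Proof.
move=> c2 cc uc; rewrite /has_cycle c2; apply/existsP; exists (in_tuple c).
by rewrite /ucycleb cc.
Qed.

Lemma short_cycle_freeP (G : sgraph) :
  short_cycle_free (@adj G) <-> girth_at_least 6 G.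
Proof.
have irr : irreflexive (@adj G) by apply: adj_irr.
have sym : symmetric (@adj G) by apply: adj_sym.
have ne (x y : G) : adj x y -> x != y by apply: contraTneq => ->; rewrite irr.
split=> [[C3 C4 C5]|/girth_at_leastP g6].
  apply/girth_at_leastP => n /andP[n2 /existsP[c]]; rewrite leqNgt => ucc.
  apply/negP => n6; move: (size_tuple c) ucc; case: (tval c) => {c} /=.
    by move=> n0; rewrite -n0 in n2.
  move=> x [|y [|z [|w [|v [|u c]]]]] sz; try by move: n2 n6; rewrite -sz.
  - rewrite /ucycleb /= andbT => /andP[/and3P[xy yz zx] _].
    by have := C3 _ _ _ xy yz; rewrite zx.
  - rewrite /ucycleb /= !inE !negb_or andbT.
    move=> /andP[/and4P[xy yz zw wx] /and3P[/and3P[_ xz _] /andP[_ yw] _]].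
    by have := C4 _ _ _ _ xz yw xy yz zw; rewrite wx.
  - rewrite /ucycleb /= andbT => /andP[/and5P[xy yz zw wv vx] _].
    by have := C5 _ _ _ _ _ xy yz zw wv; rewrite vx.
have no c : 2 < size c < 6 -> cycle (@adj G) c -> ~~ uniq c.
  move=> /andP[c2 c6] cc; apply/negP => uc.
  by have := g6 _ (has_cycleP c2 cc uc); rewrite leqNgt c6.
have C3 (x y z : G) : adj x y -> adj y z -> ~~ adj z x.
  move=> xy yz; apply/negP => zx.
  have := no [:: x; y; z] isT; rewrite /= xy yz zx => /(_ isT).
  by rewrite !inE !negb_or (ne _ _ xy) (ne _ _ yz) eq_sym (ne _ _ zx).
split=> // [x y z w xz yw xy yz zw|x y z w v xy yz zw wv]; apply/negP.
  move=> wx; have := no [:: x; y; z; w] isT; rewrite /= xy yz zw wx => /(_ isT).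
  rewrite !inE !negb_or xz yw (ne _ _ xy) (ne _ _ yz) (ne _ _ zw).
  by rewrite eq_sym (ne _ _ wx).
move=> vx; have := no [:: x; y; z; w; v] isT.
rewrite /= xy yz zw wv vx => /(_ isT).
have tri (a b c : G) : adj a b -> adj b c -> adj c a -> False.
  by move=> ab bc ca; have := C3 _ _ _ ab bc; rewrite ca.
rewrite !inE !negb_or (ne _ _ xy) (ne _ _ yz) (ne _ _ zw) (ne _ _ wv).
rewrite (eq_sym x v) (ne _ _ vx) !andbT /=; apply/negP; rewrite negbK.
have nz (a b : G) : (a = b -> False) -> a != b by move=> ?; apply/eqP.
apply/and3P; split; [apply/andP; split| apply/andP; split|]; apply: nz => eq_.
- by apply: (tri _ _ _ zw wv); rewrite -eq_.
- by apply: (tri _ _ _ xy yz); rewrite eq_.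
- by apply: (tri _ _ _ wv vx); rewrite -eq_.
- by apply: (tri _ _ _ yz zw); rewrite eq_.
- by apply: (tri _ _ _ xy yz); rewrite eq_.
Qed.

Section Minimal.

Variable G : sgraph.
Hypothesis G6 : girth_at_least 6 G.
Hypothesis G28 : #|G| <= 28.

Let colourable_on (W : {set G}) : Prop :=
  exists f : G -> 'I_3, {in W &, forall x y, adj x y -> f x != f y}.

(** In a minimal set [W] of vertices that is not 3-colourable, a vertex with at most two
    neighbours could be coloured last. So the graph induced by [W] has minimum
    degree 3. *)
Lemma colourable3 : colourable G 3.
Proof.
apply: contrapT => nG.
have nT : ~ colourable_on [set: G].
  move=> [f fP]; apply: nG; apply/existsP; exists [ffun x => f x].
  apply/forallP => x; apply/forallP => y; apply/implyP => xy.
  by rewrite !ffunE fP ?inE.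
have [W /minsetP[/asboolP nW minW] _] :=
  @minset_exists _ (fun W => `[< ~ colourable_on W >]) _ (asboolT nT).
pose T : finType := {x : G | x \in W}.
pose e : rel T := fun x y => adj (val x) (val y).
have e_sym : symmetric e by move=> x y; apply: adj_sym.
have e_irr : irreflexive e by move=> x; apply: adj_irr.
have [C3 C4 C5] := (short_cycle_freeP G).2 G6.
have short : short_cycle_free e.
  split=> [x y z|x y z w xz yw|x y z w v]; [exact: C3|exact: C4|exact: C5].
have cT : #|T| <= 28 by rewrite card_sig; apply: leq_trans (max_card _) G28.
apply: (counting_contradiction e_sym e_irr short cT) => [x|[f fP]]; last first.
  apply: nW; exists (fun x => if insub x is Some u then f u else ord0).
  by move=> x y xW yW xy; rewrite !insubT; apply: fP.
rewrite leqNgt; apply/negP => dx; apply: nW.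
have [f fP] : colourable_on (W :\ val x).
  apply: contrapT => nWx; have := minW _ (asboolT nWx) (subD1set _ _).
  by move/setP => /(_ (val x)); rewrite !inE eqxx (valP x).
have [c cP] : exists c, c \notin [set f (val y) | y in nb e x].
  apply/existsP; rewrite -negb_forall; apply/negP => /forallP all_c.
  have : #|'I_3| <= #|[set f (val y) | y in nb e x]|.
    by apply/subset_leq_card/subsetP => c _; apply: all_c.
  rewrite card_ord leqNgt => /negP; apply.
  exact: leq_ltn_trans (leq_imset_card _ _) dx.
exists (fun y => if y == val x then c else f y).
have new y : y \in W -> adj (val x) y -> c != f y.
  move=> yW xy; apply: contraNneq cP => ->.
  by apply/imsetP; exists (Sub y yW); rewrite // inE.
move=> y z yW zW yz; have [yx|yx] := eqVneq y (val x);
  have [zx|zx] := eqVneq z (val x).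
- by rewrite yx zx adj_irr in yz.
- by apply: new; rewrite // -yx.
- by rewrite eq_sym; apply: new; rewrite // -zx adj_sym.
by apply: fP; rewrite // !inE ?yx ?zx.
Qed.

End Minimal.

(** * A graph of girth 6 and chromatic number 4 *)

Definition heptagon : rel 'I_7 :=
  fun i j => (j == i.+1 %% 7 :> nat) || (i == j.+1 %% 7 :> nat).

(** The construction of Blanche Descartes from the cycle of length 7: 19 points and, for
    every injective map [f] from the heptagon to the points, a copy of the heptagon
    joined to its points by [f]. Non-injective maps contribute isolated heptagons, which
    do no harm and keep the vertex type simple. *)
Definition descartes_vertex : finType :=
  ('I_19 + {ffun 'I_7 -> 'I_19} * 'I_7)%type.

Definition descartes_adj : rel descartes_vertex := fun a b =>
  match a, b with
  | inl _, inl _ => false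
  | inl s, inr (f, i) | inr (f, i), inl s => injectiveb f && (f i == s)
  | inr (f, i), inr (g, j) => (f == g) && heptagon i j
  end.

Lemma heptagonP (i j : 'I_7) : heptagon i j ->
  i.+1 = j :> nat \/ j.+1 = i :> nat \/ i + 6 = j :> nat \/ j + 6 = i :> nat.
Proof. by have := ltn_ord i; have := ltn_ord j; rewrite /heptagon; lia. Qed.

Lemma heptagon_sym : symmetric heptagon.
Proof. by move=> i j; rewrite /heptagon orbC. Qed.

Lemma heptagon_irr : irreflexive heptagon.
Proof. by move=> i; apply/negP => /heptagonP; lia. Qed.

Lemma heptagon_short : short_cycle_free heptagon.
Proof.
split=> [x y z|x y z w|x y z w v].
- by move=> /heptagonP xy /heptagonP yz; apply/negP => /heptagonP; lia.
- move=> xz yw /heptagonP xy /heptagonP yz /heptagonP zw.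
  have {}xz : x <> z :> nat by move/val_inj; apply/eqP.
  have {}yw : y <> w :> nat by move/val_inj; apply/eqP.
  have [x7 y7 z7 w7] := And4 (ltn_ord x) (ltn_ord y) (ltn_ord z) (ltn_ord w).
  by apply/negP => /heptagonP; lia.
move=> /heptagonP xy /heptagonP yz /heptagonP zw /heptagonP wv.
by apply/negP => /heptagonP; lia.
Qed.

Lemma descartes_sym : symmetric descartes_adj.
Proof.
by move=> [s|[f i]] [t|[g j]] //=; rewrite eq_sym heptagon_sym.
Qed.

Lemma descartes_irr : irreflexive descartes_adj.
Proof. by move=> [s|[f i]] //=; rewrite heptagon_irr andbF. Qed.

Definition descartes := SGraph descartes_sym descartes_irr.

Section PointNeighbours.

Variable s : 'I_19.
Notation adj := descartes_adj.

Lemma point_nb a : adj (inl s) a ->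
  exists f i, [/\ a = inr (f, i), injective f & f i = s].
Proof. by case: a => // -[f i] /= /andP[/injectiveP injf /eqP fi]; exists f, i. Qed.

Lemma copy_nb f i t : adj (inr (f, i)) (inl t) -> f i = t.
Proof. by case/andP=> _ /eqP. Qed.

Lemma point3 a b : adj (inl s) a -> adj a b -> adj b (inl s) -> False.
Proof.
move=> /point_nb[f [i [-> injf fi]]] ab; rewrite descartes_sym.
move=> /point_nb[g [j [def_b _ gj]]]; move: ab; rewrite def_b.
move=> /= /andP[/eqP fg]; rewrite -fg -fi in gj.
by rewrite (injf _ _ gj) heptagon_irr.
Qed.

Lemma point4 a b c : inl s != b -> a != c ->
  adj (inl s) a -> adj a b -> adj b c -> adj c (inl s) -> False.
Proof.
move=> nb nac /point_nb[f [i [def_a injf fi]]] + + cs.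
move: cs; rewrite descartes_sym => /point_nb[g [j [def_c _ gj]]].
rewrite def_a def_c in nac *; case: b nb => [t|[h k] _].
  by move=> nst /copy_nb; rewrite fi => st; rewrite st eqxx in nst.
move=> /= /andP[/eqP fh _] /andP[/eqP hg _]; rewrite -hg -fh -fi in gj nac.
by rewrite (injf _ _ gj) eqxx in nac.
Qed.

Lemma point5 a b c d :
  adj (inl s) a -> adj a b -> adj b c -> adj c d -> adj d (inl s) -> False.
Proof.
move=> sa ab bc cd ds; have [f [i [def_a injf fi]]] := point_nb sa.
have := ds; rewrite descartes_sym => /point_nb[g [j [def_d _ gj]]].
case: b ab bc => [t|[h k]] ab bc.
  rewrite def_a in ab; have st := copy_nb ab; rewrite fi in st.
  by rewrite -st in bc; apply: point3 bc cd ds.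
case: c bc cd => [t|[l m]] bc cd.
  rewrite def_d descartes_sym in cd; have st := copy_nb cd; rewrite gj in st.
  by rewrite -st in bc; apply: point3 sa ab bc.
have [C3 _ _] := heptagon_short.
rewrite def_a def_d /= in ab bc cd gj.
case/andP: ab bc cd => [/eqP fh ik] /andP[/eqP hl km] /andP[/eqP lg mj].
rewrite -lg -hl -fh -fi in gj; rewrite (injf _ _ gj) in mj.
by have := C3 _ _ _ ik km; rewrite mj.
Qed.

End PointNeighbours.

(** A point has at most one neighbour in each heptagon and a heptagon vertex has at most
    one neighbour among the points; so a cycle of length at most 5 would have to
    stay in one heptagon. *)
Lemma descartes_short : short_cycle_free descartes_adj.
Proof.
have [C3 C4 C5] := heptagon_short.
have sym := descartes_sym.
split=> [x y z xy yz|x y z w xz yw xy yz zw|x y z w v xy yz zw wv]; apply/negP.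
- move=> zx; case: x xy zx => [s|[f i]] xy zx; first exact: point3 xy yz zx.
  case: y xy yz => [s|[g j]] xy yz; first exact: point3 yz zx xy.
  case: z yz zx => [s|[h k]] yz zx; first exact: point3 zx xy yz.
  case/andP: xy yz zx => _ ij /andP[_ jk] /andP[_ ki].
  by have := C3 _ _ _ ij jk; rewrite ki.
- move=> wx; case: x xz xy wx => [s|[f i]] xz xy wx.
    exact: point4 xz yw xy yz zw wx.
  case: y yw xy yz => [s|[g j]] yw xy yz.
    by rewrite eq_sym in xz; apply: point4 yw xz yz zw wx xy.
  case: z xz yz zw => [s|[h k]] xz yz zw.
    by rewrite eq_sym in xz; rewrite eq_sym in yw; apply: point4 xz yw zw wx xy yz.
  case: w yw zw wx => [s|[l m]] yw zw wx.
    by rewrite eq_sym in yw; apply: point4 yw xz wx xy yz zw.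
  case/andP: xy yz zw wx => /eqP fg ij /andP[/eqP gh jk] /andP[/eqP hl km] /andP[_ mi].
  have ik : i != k by apply: contraNneq xz => ->; rewrite fg gh.
  have jm : j != m by apply: contraNneq yw => ->; rewrite gh hl.
  by have := C4 _ _ _ _ ik jm ij jk km; rewrite mi.
move=> vx; case: x xy vx => [s|[f i]] xy vx; first exact: point5 xy yz zw wv vx.
case: y xy yz => [s|[g j]] xy yz; first exact: point5 yz zw wv vx xy.
case: z yz zw => [s|[h k]] yz zw; first exact: point5 zw wv vx xy yz.
case: w zw wv => [s|[l m]] zw wv; first exact: point5 wv vx xy yz zw.
case: v wv vx => [s|[o n]] wv vx; first exact: point5 vx xy yz zw wv.
case/andP: xy yz zw wv vx => _ ij /andP[_ jk] /andP[_ km] /andP[_ mn] /andP[_ ni].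
by have := C5 _ _ _ _ _ ij jk km mn; rewrite ni.
Qed.

Lemma descartes_colourable4 : colourable descartes 4.
Proof.
pose col (i : 'I_7) : 'I_4 := if i == 6 :> nat then inord 2 else inord (odd i).
apply/existsP; exists [ffun x : descartes_vertex =>
  if x is inr (f, i) then col i else inord 3].
apply/forallP => x; apply/forallP => y; apply/implyP => xy; rewrite !ffunE.
have col3 i : col i != inord 3.
  by rewrite /col -val_eqE; case: ifP => _; rewrite /= !inordK //; case: (odd i).
case: x y xy => [s|[f i]] [t|[g j]] //= xy; first by rewrite eq_sym.
case/andP: xy => _ /heptagonP ij; rewrite /col -val_eqE.
have [i7 j7] := (ltn_ord i, ltn_ord j).
by case: ifP => [/eqP i6|/eqP i6]; case: ifP => [/eqP j6|/eqP j6];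
   rewrite /= !inordK; do ?[by case: (odd _)]; lia.
Qed.

(** Seven of the 19 points share a colour. The heptagon attached to them would have to do
    with the two other colours. *)
Lemma descartes_not_colourable3 : ~~ colourable descartes 3.
Proof.
apply/existsP => -[g /forallP gP].
have gE x y : descartes_adj x y -> g x != g y.
  by move=> xy; have /forallP/(_ y)/implyP := gP x; apply.
have [c cP] : exists c, 7 <= #|[set s | g (inl s) == c]|.
  apply: contrapT => none.
  have : #|'I_19| = \sum_(c : 'I_3) #|[set s : 'I_19 | g (inl s) == c]|.
    rewrite -sum1_card (partition_big (fun s => g (inl s)) xpredT) //=.
    by apply: eq_bigr => c _; rewrite sum1dep_card.
  rewrite card_ord => def19.
  have : \sum_(c : 'I_3) #|[set s : 'I_19 | g (inl s) == c]| <= \sum_(c : 'I_3) 6.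
    apply: leq_sum => c _; rewrite leqNgt; apply/negP => c7.
    by apply: none; exists c.
  by rewrite -def19 sum_nat_const card_ord.
pose f := [ffun i : 'I_7 => enum_val (widen_ord cP i)].
have injf : injective f.
  by move=> i j; rewrite !ffunE => /enum_val_inj/(congr1 val)/= /val_inj.
have fc i : g (inl (f i)) = c.
  by rewrite ffunE; have := enum_valP (widen_ord cP i); rewrite inE => /eqP.
pose k (n : nat) := g (inr (f, inord n)).
have kc n : k n != c.
  rewrite -(fc (inord n)) eq_sym; apply: gE => /=.
  by rewrite eqxx andbT; apply/injectiveP.
have kk n m : heptagon (inord n) (inord m) -> k n != k m.
  by move=> nm; apply: gE; rewrite /= eqxx.
have three (a b d : 'I_3) : a != c -> b != c -> d != c -> a != b -> b != d -> a = d.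
  move: a b d (c); do 4!case=> [[|[|[|//]]] ?]; rewrite -!val_eqE //= => *;
    exact/val_inj.
have step n : n < 5 -> k n = k n.+2.
  move=> n5; apply: (three _ (k n.+1)) => //; apply: kk;
    by rewrite /heptagon !inordK; lia.
have := kk 6 0; rewrite -(step 4) // -(step 2) // -(step 0) // eqxx.
by move=> /(_ _)/negP; apply => //; rewrite /heptagon !inordK.
Qed.

Lemma colourableS (G : sgraph) k l : k <= l -> colourable G k -> colourable G l.
Proof.
move=> kl /existsP[f /forallP fP]; apply/existsP.
exists [ffun x => widen_ord kl (f x)]; apply/forallP => x; apply/forallP => y.
apply/implyP => xy; rewrite !ffunE -val_eqE /=.
by have /forallP/(_ y)/implyP/(_ xy) := fP x.
Qed.

Lemma chromatic_number_le (G : sgraph) k : colourable G k -> chromatic_number G <= k.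
Proof. by rewrite /chromatic_number; case: ex_minnP => m _; apply. Qed.

Lemma chromatic_number_colourable (G : sgraph) : colourable G (chromatic_number G).
Proof. by rewrite /chromatic_number; case: ex_minnP. Qed.

Lemma chromatic_number_descartes : chromatic_number descartes = 4.
Proof.
apply/eqP; rewrite eqn_leq chromatic_number_le ?descartes_colourable4 //=.
rewrite ltnNge; apply: contra descartes_not_colourable3 => le3.
exact: colourableS le3 (chromatic_number_colourable _).
Qed.

Theorem theorem2 :
  (forall G : sgraph, girth_at_least 6 G -> #|G| <= 28 -> colourable G 3) /\
  29 <= min_order 6 4.
Proof.
split; first exact: colourable3.
rewrite /min_order; set P : pred nat := fun n => _.
have [|m [-> /asboolP[G [cG xG gG]] _]] := @min_natP P.
  exists #|descartes|; apply/asboolP; exists descartes; split=> //.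
    exact: chromatic_number_descartes.
  exact/short_cycle_freeP/descartes_short.
rewrite /= ltnNge -cG; apply/negP => le28.
by have := chromatic_number_le (colourable3 gG le28); rewrite xG.
Qed.
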